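(* Let $\Omega$ be a well-distributed collection of intervals of $\mathbb{R}$ satisfying $$\inf_{\omega\in\Omega}|\omega|\simeq \sup_{\omega\in\Omega}|\omega| .$$ Then for all exponents $p_1,p_2,p_3'\in[2,\infty]$ (where $p_3'$ is the conjugate exponent of $p_3$) satisfying $$0<\frac1{p_3}=\frac1{p_1}+\frac1{p_2},$$ there exists a constant $C$, independent of the collection $\Omega$, such that for all $f,g\in\mathcal{S}(\mathbb{R})$, $$\left\|\Big(\sum_{\omega\in\Omega}|T_{\chi_\omega}(f,g)|^2\Big)^{1/2}\right\|_{L^{p_3}(\mathbb{R})}\le C\,\|f\|_{L^{p_1}(\mathbb{R})}\,\|g\|_{L^{p_2}(\mathbb{R})}.$$
   Context: Intervals are bounded with positive length $|\omega|$; $2\omega$ is the interval with the same center as $\omega$ and twice its length. A collection $\Omega$ of intervals is well-distributed if $\sum_{\omega\in\Omega}\mathbf{1}_{2\omega}\lesssim 1$, i.e. this sum is bounded by a constant. The condition $\inf|\omega|\simeq\sup|\omega|$ means $\sup_{\omega\in\Omega}|\omega|\le K\inf_{\omega\in\Omega}|\omega|$ for a constant $K$. For each $\omega\in\Omega$, $\chi_\omega$ is a smooth function on $\mathbb{R}$ with support contained in $\omega$ such that for every integer $i\ge 0$, $\|D^{(i)}\chi_\omega\|_{L^\infty(\mathbb{R})}\le C_i|\omega|^{-i}$, with constants $C_i$ independent of $\omega$. The bilinear operator $T_{\chi_\omega}$ is $$T_{\chi_\omega}(f,g)(x)=\int_{\mathbb{R}^2}e^{ix(\xi+\eta)}\widehat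 f(\xi)\widehat g(\eta)\chi_\omega(\eta-\xi)\,d\xi\,d\eta,\qquad \widehat f(\xi)=\int_{\mathbb{R}}f(x)e^{-ix\xi}\,dx .$$ ''Independent of the collection $\Omega$'' means that $C$ depends only on the exponents and on the implicit constants above (the bound in the well-distribution condition, $K$, and the $C_i$). $\mathcal{S}(\mathbb{R})$ is the Schwartz space. *)

(* Defs.v *)
(* MathComp-Analysis, with R[i] from mathcomp-real-closed as complex numbers. *)
From HB Require Import structures.
From mathcomp Require Import all_boot all_order all_algebra.
From mathcomp Require Import all_classical all_reals all_analysis.
From mathcomp Require Import complex.

Set Implicit Arguments.
Unset Strict Implicit.
Unset Printing Implicit Defensive.
Import Order.TTheory GRing.Theory Num.Theory.
Import numFieldNormedType.Exports.
Import ComplexField.Normc.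

Local Open Scope classical_set_scope.
Local Open Scope ring_scope.
Local Open Scope complex_scope.

Definition bounded_interval (R : realType) (w : set R) : Prop :=
  [/\ is_interval w, has_inf w, has_sup w & inf w < sup w].

Definition ilength (R : realType) (w : set R) : R := sup w - inf w.

Definition icenter (R : realType) (w : set R) : R := (inf w + sup w) / 2.

(* The endpoints of [idouble w] belong to it exactly when those of [w] belong
   to [w]. *)
Definition idouble (R : realType) (w : set R) : set R :=
  [set icenter w + 2 * (x - icenter w) | x in w].

Definition well_distributed (R : realType) (N : R) (Omega : set (set R)) :
    Prop :=
  forall x : R, (\esum_(w in Omega) (\1_(idouble w) x : R)%:E <= N%:E)%E.

(* Computed in \bar R: false when the lengths are unbounded; true for the empty
   collection, where the sup is -oo and the inf is +oo. *)
Definition comparable_lengths (R : realType) (K : R) (Omega : set (set R)) :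
    Prop :=
  (ereal_sup [set (ilength w)%:E | w in Omega] <=
     K%:E * ereal_inf [set (ilength w)%:E | w in Omega])%E.

Definition expi (R : realType) (t : R) : R[i] := cos t +i* sin t.

Definition cintegral d (T : measurableType d) (R : realType)
    (mu : {measure set T -> \bar R}) (f : T -> R[i]) : R[i] :=
  (\int[mu]_x complex.Re (f x)) +i* (\int[mu]_x complex.Im (f x)).

(* [derive1n] is taken of the real and imaginary parts because R[i] carries no
   normed module structure over R. *)
Definition cderive1n (R : realType) (n : nat) (f : R -> R[i]) (x : R) : R[i] :=
  derive1n n (fun t => complex.Re (f t)) x +i*
  derive1n n (fun t => complex.Im (f t)) x.

Definition csmooth (R : realType) (f : R -> R[i]) : Prop :=
  forall (n : nat) (x : R),
    derivable (derive1n n (fun t => complex.Re (f t))) x 1 /\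
    derivable (derive1n n (fun t => complex.Im (f t))) x 1.

Definition csupport (R : realType) (f : R -> R[i]) : set R :=
  closure [set x | f x != 0].

Definition schwartz (R : realType) (f : R -> R[i]) : Prop :=
  csmooth f /\
  forall m n : nat, exists M : R,
    forall x : R, `|x| ^+ m * normc (cderive1n n f x) <= M.

Definition cLnorm (R : realType) (p : \bar R) (f : R -> R[i]) : \bar R :=
  Lnorm (@lebesgue_measure R) p (fun x => (normc (f x))%:E).

Definition fourier (R : realType) (f : R -> R[i]) (xi : R) : R[i] :=
  cintegral (@lebesgue_measure R) (fun x => f x * expi (- (x * xi))).

Definition bilinear_op (R : realType) (chi f g : R -> R[i]) (x : R) : R[i] :=
  cintegral (@lebesgue_measure R \x @lebesgue_measure R)%E
    (fun z : measurableTypeR R * measurableTypeR R =>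
       expi (x * (z.1 + z.2)) * fourier f z.1 * fourier g z.2
         * chi (z.2 - z.1)).

Definition adapted (R : realType) (Cst : nat -> R) (w : set R)
    (chi : R -> R[i]) : Prop :=
  [/\ csmooth chi, csupport chi `<=` w &
      forall i : nat,
        (cLnorm +oo (cderive1n i chi) <= (Cst i * ilength w ^- i)%:E)%E].

Definition square_function (R : realType) (Omega : set (set R))
    (chi : set R -> R -> R[i]) (f g : R -> R[i]) (x : R) : \bar R :=
  ((\esum_(w in Omega) (normc (bilinear_op (chi w) f g x) ^+ 2)%:E)
     `^ 2^-1)%E.

(* Main.v *)
Require Import Defs.
From mathcomp Require Import all_boot all_order all_algebra.
From mathcomp Require Import all_classical all_reals all_analysis.
From mathcomp Require Import measurable_realfun ess_sup_inf complex.
From mathcomp Require Import ring lra.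

(** The proof is carried out in physical space and at the level of pointwise
    bounds: the collection [Omega] is summed out first, by orthogonality, and
    exponents enter only afterwards.

    Fourier inversion turns the bilinear operator into
      [T_chi(f,g)(x) = 2 pi int f(x-t) g(x+t) chi^(t) dt]   ([bilinear_opE]),
    so for fixed [x] it is a pairing of [chi^] with one function of [t] that is
    common to all intervals.  Let [L] be the length of one of the intervals;
    all the others are comparable to it.  Multiplying and dividing [chi^(t)]
    by [1 + L^2 t^2] and undoing one Fourier transform gives
      [T_chi(f,g)(x) = 2 pi int psi(u) h_x^(u) du],
    where [psi = chi - L^2 chi''] is bounded by a constant and supported in
    the interval of [chi], and
      [h_x(t) = f(x-t) g(x+t) / (1 + L^2 t^2)]   ([bilinear_op_damped]).
    Cauchy-Schwarz on each interval, the bounded overlap and Bessel's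
    inequality [bessel] then give, at every [x],
      [sum_w |T_(chi_w)(f,g)(x)|^2 <= C L M(x)],
      [M(x) = int |f(x-t)|^2 |g(x+t)|^2 / (1 + L^2 t^2)^2 dt]
    ([esum_sqr_bilinear_op_le]).

    It remains to bound the integral of [(L M)^q], where [q = p3 / 2].  The
    hypothesis [p3' >= 2] says exactly that [q <= 1].  Concavity of the power
    [q] then makes the integral of [M^q] at most that of [(B * M)^q], with [B]
    the uniform density on an interval of length [2/L] around the origin
    ([integral_poweR_le_convolution]).  In [B * M] the points [x-t] and [x+t]
    become independent variables, and the decay in [t] dominates that of both
    distances to the centre of the average, so that
      [L (B * M) <= C (k * |f|^2) (k * |g|^2)]
    with [k] the Cauchy density at scale [1/L] ([box_midpoint_mean_le]); all
    powers of [L] have cancelled.  Finally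
      [k * |f|^2 <= (k * |f|^p1)^(2/p1)]
    because [p1 >= 2] (if [p1] is infinite the left-hand side is at most the
    squared supremum of [|f|]), likewise for [g], and Hoelder's inequality with
    exponents [p1/p3] and [p2/p3] concludes, since averaging against [k]
    preserves integrals ([integral_convolution_sqr_le]).

    The Fourier analysis rests on a single explicit pair: the transform of
    [exp(-e|u|)] is twice the kernel [e / (e^2 + t^2)].  It provides Fourier
    inversion and Bessel's inequality by Abel summation, and the same kernel is
    the weight [1 / (1 + L^2 t^2)] above. *)

Set Implicit Arguments.
Unset Strict Implicit.
Unset Printing Implicit Defensive.
Import Order.TTheory GRing.Theory Num.Theory.
Import numFieldNormedType.Exports.
Import ComplexField.Normc.
Local Open Scope classical_set_scope.
Local Open Scope ring_scope.
Local Open Scope complex_scope.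

(** * Integration of complex-valued functions *)

Section complex_integrals.
Context d (T : measurableType d) (R : realType).
Variable mu : {measure set T -> \bar R}.
Implicit Types (f g : T -> R[i]) (c z : R[i]).

Definition cmeasurable f :=
  measurable_fun setT (fun x => complex.Re (f x)) /\
  measurable_fun setT (fun x => complex.Im (f x)).

Definition cintegrable f :=
  mu.-integrable setT (fun x => (complex.Re (f x))%:E) /\
  mu.-integrable setT (fun x => (complex.Im (f x))%:E).

Lemma normcE z : normc z = Num.sqrt (complex.Re z ^+ 2 + complex.Im z ^+ 2).
Proof. by case: z. Qed.

Lemma normc_ge0 z : 0 <= normc z.
Proof. by rewrite normcE sqrtr_ge0. Qed.

Lemma sqr_normcE z : normc z ^+ 2 = complex.Re z ^+ 2 + complex.Im z ^+ 2.
Proof. by rewrite normcE sqr_sqrtr// addr_ge0// sqr_ge0. Qed.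

Lemma Re_le_normc z : `|complex.Re z| <= normc z.
Proof. by rewrite normcE -sqrtr_sqr ler_wsqrtr// lerDl sqr_ge0. Qed.

Lemma Im_le_normc z : `|complex.Im z| <= normc z.
Proof. by rewrite normcE -sqrtr_sqr ler_wsqrtr// lerDr sqr_ge0. Qed.

Lemma normc_le_ReIm z : normc z <= `|complex.Re z| + `|complex.Im z|.
Proof.
rewrite -(@ler_pXn2r _ 2)// ?nnegrE ?normc_ge0 ?addr_ge0// sqr_normcE.
rewrite -(real_normK (num_real (complex.Re z))) -(real_normK (num_real (complex.Im z))).
rewrite sqrrD -addrA lerD2l lerDr mulrn_wge0// mulr_ge0//.
Qed.

Lemma normc_conjc z : normc (conjc z) = normc z.
Proof. by case: z => a b; rewrite /= sqrrN. Qed.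

Lemma conjcM (x y : R[i]) : conjc (x * y) = conjc x * conjc y.
Proof. exact: rmorphM. Qed.

Lemma conjcR (r : R) : conjc (r%:C) = r%:C.
Proof. by rewrite /= oppr0. Qed.

Lemma normcR (r : R) : normc (r%:C) = `|r|.
Proof. by rewrite /= expr0n addr0 sqrtr_sqr. Qed.

Lemma ReM (x y : R[i]) : complex.Re (x * y) =
  complex.Re x * complex.Re y - complex.Im x * complex.Im y.
Proof. by case: x; case: y. Qed.

Lemma ImM (x y : R[i]) : complex.Im (x * y) =
  complex.Re x * complex.Im y + complex.Im x * complex.Re y.
Proof. by case: x; case: y. Qed.

Lemma ReZ (r : R) z : complex.Re (r%:C * z) = r * complex.Re z.
Proof. by rewrite ReM /= mul0r subr0. Qed.

Lemma ImZ (r : R) z : complex.Im (r%:C * z) = r * complex.Im z.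
Proof. by rewrite ImM /= mul0r addr0. Qed.

Lemma ReD (x y : R[i]) : complex.Re (x + y) = complex.Re x + complex.Re y.
Proof. by case: x; case: y. Qed.

Lemma ImD (x y : R[i]) : complex.Im (x + y) = complex.Im x + complex.Im y.
Proof. by case: x; case: y. Qed.

Lemma complex_eqP (x y : R[i]) :
  complex.Re x = complex.Re y -> complex.Im x = complex.Im y -> x = y.
Proof. by case: x; case: y => ? ? ? ? /= -> ->. Qed.

Lemma cmeasurable_normc f : cmeasurable f ->
  measurable_fun setT (fun x => normc (f x)).
Proof.
move=> [mr mi].
under eq_fun do rewrite normcE.
apply: (@measurableT_comp _ _ _ _ _ _ (@Num.sqrt R)).
  by apply: continuous_measurable_fun; exact: sqrt_continuous.
by apply: measurable_funD; exact: measurable_funX.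
Qed.

Lemma cmeasurableM f g : cmeasurable f -> cmeasurable g ->
  cmeasurable (fun x => f x * g x).
Proof.
move=> [fr fi] [gr gi]; split.
- under eq_fun do rewrite ReM.
  by apply: measurable_funB; apply: measurable_funM.
- under eq_fun do rewrite ImM.
  by apply: measurable_funD; apply: measurable_funM.
Qed.

Lemma cmeasurableD f g : cmeasurable f -> cmeasurable g ->
  cmeasurable (fun x => f x + g x).
Proof.
move=> [fr fi] [gr gi]; split.
- by under eq_fun do rewrite ReD; apply: measurable_funD.
- by under eq_fun do rewrite ImD; apply: measurable_funD.
Qed.

Lemma cmeasurable_conj f : cmeasurable f -> cmeasurable (fun x => conjc (f x)).
Proof.
move=> [fr fi]; split.
- by rewrite (_ : (fun _ => _) = fun x => complex.Re (f x))//; apply/funext => x; case: (f x).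
- rewrite (_ : (fun _ => _) = fun x => - complex.Im (f x)); first exact: measurableT_comp.
  by apply/funext => x; case: (f x).
Qed.

Lemma cmeasurable_cst c : cmeasurable (fun=> c).
Proof. by split. Qed.

Lemma cmeasurable_real (h : T -> R) : measurable_fun setT h ->
  cmeasurable (fun x => (h x)%:C).
Proof. by move=> mh; split. Qed.

Lemma cmeasurable_expi (h : T -> R) : measurable_fun setT h ->
  cmeasurable (fun x => expi (h x)).
Proof.
move=> mh; split => /=.
- apply: measurableT_comp => //; apply: continuous_measurable_fun.
  exact: continuous_cos.
- apply: measurableT_comp => //; apply: continuous_measurable_fun.
  exact: continuous_sin.
Qed.

Lemma cintegrable_measurable f : cintegrable f -> cmeasurable f.
Proof.
move=> [/measurable_int fr /measurable_int fi].
by split; apply/measurable_EFinP.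
Qed.

Lemma le_cintegrable f (h : T -> \bar R) : cmeasurable f ->
  mu.-integrable setT h -> (forall x, (normc (f x))%:E <= `|h x|)%E ->
  cintegrable f.
Proof.
move=> [fr fi] ih fh; split; (apply: (le_integrable measurableT _ _ ih);
    first exact/measurable_EFinP).
- by move=> x _; apply: le_trans (fh x); rewrite lee_fin Re_le_normc.
- by move=> x _; apply: le_trans (fh x); rewrite lee_fin Im_le_normc.
Qed.

Lemma cintegrable_normc f : cintegrable f ->
  mu.-integrable setT (fun x => (normc (f x))%:E).
Proof.
move=> [fr fi].
have ia := integrableD measurableT (integrable_abse fr) (integrable_abse fi).
apply: (le_integrable measurableT _ _ ia).
- apply/measurable_EFinP; apply: cmeasurable_normc; exact: cintegrable_measurable.
- move=> x _ /=; rewrite lee_fin ger0_norm ?normc_ge0//.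
  by apply: le_trans (ler_norm _); exact: normc_le_ReIm.
Qed.

Lemma cintegrableP f : cintegrable f <->
  cmeasurable f /\ (\int[mu]_x (normc (f x))%:E < +oo)%E.
Proof.
split=> [fi|[mf foo]].
  split; first exact: cintegrable_measurable.
  have /integrableP[_] := cintegrable_normc fi.
  by under eq_integral do rewrite /= ger0_norm ?normc_ge0//.
apply: (@le_cintegrable _ (fun x => (normc (f x))%:E)) => //.
  apply/integrableP; split; first exact/measurable_EFinP/cmeasurable_normc.
  by under eq_integral do rewrite /= ger0_norm ?normc_ge0//.
by move=> x /=; rewrite ger0_norm ?normc_ge0.
Qed.

Lemma cintegrableMbounded f g (M : R) : cintegrable f -> cmeasurable g ->
  (forall x, normc (g x) <= M) -> cintegrable (fun x => f x * g x).
Proof.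
move=> fi mg gM.
apply: (@le_cintegrable _ (fun x => M%:E * (normc (f x))%:E)%E).
- by apply: cmeasurableM => //; exact: cintegrable_measurable.
- by apply: integrableZl => //; exact: cintegrable_normc.
- move=> x /=; rewrite lee_fin normcM mulrC normrM.
  apply: ler_pM; rewrite ?normc_ge0//.
  + exact: le_trans (ler_norm _).
  + exact: ler_norm.
Qed.

Lemma cintegrableZ c f : cintegrable f -> cintegrable (fun x => c * f x).
Proof.
move=> fi; under eq_fun do rewrite mulrC.
by apply: (@cintegrableMbounded _ (fun=> c) (normc c)) => //; exact: cmeasurable_cst.
Qed.

Lemma cintegrableD f g : cintegrable f -> cintegrable g ->
  cintegrable (fun x => f x + g x).
Proof.
move=> [fr fi] [gr gi]; split.
- by under eq_fun do rewrite ReD EFinD; exact: integrableD.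
- by under eq_fun do rewrite ImD EFinD; exact: integrableD.
Qed.

Lemma cintegralD f g : cintegrable f -> cintegrable g ->
  cintegral mu (fun x => f x + g x) = cintegral mu f + cintegral mu g.
Proof.
move=> [fr fi] [gr gi]; rewrite /cintegral; apply: complex_eqP => /=.
- by under eq_Rintegral do rewrite ReD; rewrite RintegralD.
- by under eq_Rintegral do rewrite ImD; rewrite RintegralD.
Qed.

Lemma integrable_scale (r : R) (h : T -> R) :
  mu.-integrable setT (fun x => (h x)%:E) ->
  mu.-integrable setT (EFin \o (fun x => r * h x)).
Proof.
move=> ih; rewrite (_ : _ \o _ = (fun x => r%:E * (h x)%:E)%E)//.
exact: integrableZl.
Qed.

Lemma cintegralZl c f : cintegrable f ->
  cintegral mu (fun x => c * f x) = c * cintegral mu f.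
Proof.
move=> [fr fi]; rewrite /cintegral; case: c => a b; apply: complex_eqP => /=.
- under eq_Rintegral do rewrite ReM /=.
  rewrite RintegralB//; [|exact: integrable_scale..].
  by rewrite !RintegralZl.
- under eq_Rintegral do rewrite ImM /=.
  rewrite RintegralD//; [|exact: integrable_scale..].
  by rewrite !RintegralZl.
Qed.

Lemma cintegralZr c f : cintegrable f ->
  cintegral mu (fun x => f x * c) = cintegral mu f * c.
Proof.
by move=> fi; rewrite mulrC -cintegralZl//; under eq_fun do rewrite mulrC.
Qed.

Lemma cintegral_conj f : cintegrable f ->
  cintegral mu (fun x => conjc (f x)) = conjc (cintegral mu f).
Proof.
move=> [fr fi]; rewrite /cintegral; apply: complex_eqP => /=.
- by apply: eq_Rintegral => x _; case: (f x).
- rewrite -[RHS]mulN1r -RintegralZl//.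
  by apply: eq_Rintegral => x _; case: (f x) => ? ? /=; rewrite mulN1r.
Qed.

Lemma eq_cintegral f g : f =1 g -> cintegral mu f = cintegral mu g.
Proof. by move=> fg; congr cintegral; exact/funext. Qed.

Lemma cintegral_real (h : T -> R) :
  cintegral mu (fun x => (h x)%:C) = (\int[mu]_x h x)%:C.
Proof. by rewrite /cintegral /=; apply: complex_eqP => //=; rewrite /Rintegral integral0. Qed.

(** Rotation trick: if [z] is the integral of [f], the real part of
    [f * conj z / |z|] has integral [|z|] and is at most [|f|]. *)
Lemma normc_cintegral_le f : cmeasurable f ->
  ((normc (cintegral mu f))%:E <= \int[mu]_x (normc (f x))%:E)%E.
Proof.
move=> mf.
have [foo|] := ltP (\int[mu]_x (normc (f x))%:E)%E +oo%E; last first.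
  by move=> /(le_trans _); apply; exact: leey.
have fi : cintegrable f by apply/cintegrableP.
have [fr fim] := fi.
have [z0|z0] := eqVneq (normc (cintegral mu f)) 0.
  by rewrite z0; apply: integral_ge0 => x _; rewrite lee_fin normc_ge0.
pose n := normc (cintegral mu f).
have n0 : 0 < n by rewrite lt0r z0 normc_ge0.
(* (a, b) is the unit vector z / |z|. *)
pose a := complex.Re (cintegral mu f) / n; pose b := complex.Im (cintegral mu f) / n.
have ab1 : a ^+ 2 + b ^+ 2 = 1.
  rewrite /a /b !expr_div_n -mulrDl -sqr_normcE -/n divff// expf_neq0// gt_eqF.
have nE : n = \int[mu]_x (a * complex.Re (f x) + b * complex.Im (f x)).
  rewrite RintegralD//; [|exact: integrable_scale..].
  rewrite !RintegralZl// -[X in a * X]/(complex.Re (cintegral mu f)).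
  rewrite -[X in b * X]/(complex.Im (cintegral mu f)) /a /b mulrAC (mulrAC _ n^-1).
  rewrite -mulrDl -!expr2 -sqr_normcE -/n expr2 mulfK// gt_eqF.
have fE : fine (\int[mu]_x (normc (f x))%:E) = \int[mu]_x normc (f x) by [].
rewrite -/n -[leRHS]fineK; last first.
  rewrite ge0_fin_numE//; apply: integral_ge0 => x _; rewrite lee_fin normc_ge0//.
rewrite lee_fin fE nE; apply: le_Rintegral => //.
- rewrite (_ : _ \o _ = (fun x => a%:E * (complex.Re (f x))%:E + b%:E * (complex.Im (f x))%:E)%E)//.
  by apply: integrableD => //; exact: integrableZl.
- exact: cintegrable_normc.
- move=> x _; set u := complex.Re _; set v := complex.Im _.
  apply: le_trans (ler_norm _) _.
  rewrite -(@ler_pXn2r _ 2)// ?nnegrE ?normc_ge0// real_normK ?num_real//.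
  rewrite sqr_normcE -/u -/v -[leRHS]mul1r -ab1.
  (* Cauchy-Schwarz in the plane: the defect is (a v - b u)^2. *)
  have := sqr_ge0 (a * v - b * u); lra.
Qed.

Lemma cdominated_convergence (F : nat -> T -> R[i]) f (g : T -> R) :
  (forall n, cmeasurable (F n)) -> cmeasurable f ->
  mu.-integrable setT (EFin \o g) -> (forall n x, normc (F n x) <= g x) ->
  (forall x, complex.Re (F n x) @[n --> \oo] --> complex.Re (f x)) ->
  (forall x, complex.Im (F n x) @[n --> \oo] --> complex.Im (f x)) ->
  complex.Re (cintegral mu (F n)) @[n --> \oo] --> complex.Re (cintegral mu f) /\
  complex.Im (cintegral mu (F n)) @[n --> \oo] --> complex.Im (cintegral mu f).
Proof.
move=> mF mf ig Fg cr ci.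
have aux (p : R[i] -> R) : (forall z, `|p z| <= normc z) ->
    (forall n, measurable_fun setT (fun x => p (F n x))) ->
    measurable_fun setT (fun x => p (f x)) ->
    (forall x, p (F n x) @[n --> \oo] --> p (f x)) ->
    (\int[mu]_x p (F n x))%R @[n --> \oo] --> \int[mu]_x p (f x).
  move=> pn mpF mpf cp.
  have [||||| i1 _ i3] := @dominated_convergence _ _ _ mu setT measurableT
    (fun n x => (p (F n x))%:E) (fun x => (p (f x))%:E) (EFin \o g).
  - by move=> n; exact/measurable_EFinP.
  - exact/measurable_EFinP.
  - by apply/aeW => x _; apply/fine_cvgP; split; [exact: nearW|exact: cp].
  - exact: ig.
  - apply/aeW => x n _; rewrite lee_fin; exact: le_trans (Fg n x).
  - apply: fine_cvg; rewrite fineK; last exact: integrable_fin_num.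
    exact: i3.
split.
- by apply: aux => //; [exact: Re_le_normc|by move=> n; case: (mF n)|by case: mf].
- by apply: aux => //; [exact: Im_le_normc|by move=> n; case: (mF n)|by case: mf].
Qed.

End complex_integrals.

(** * Fubini for complex kernels *)

Section complex_fubini.
Context d1 d2 (T1 : measurableType d1) (T2 : measurableType d2) (R : realType).
Variable m1 : {sigma_finite_measure set T1 -> \bar R}.
Variable m2 : {sigma_finite_measure set T2 -> \bar R}.

Lemma measurable_Rintegral_section (h : T1 * T2 -> R) : measurable_fun setT h ->
  measurable_fun setT (fun s => \int[m2]_t h (s, t)).
Proof.
move=> mh.
have mh' : measurable_fun setT (EFin \o h) by exact/measurable_EFinP.
apply: (@measurableT_comp _ _ _ _ _ _ (@fine R)) => //.
rewrite (_ : (fun _ => _) = (fun s => (\int[m2]_t ((EFin \o h)^\+ (s, t)) -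
    \int[m2]_t ((EFin \o h)^\- (s, t)))%E)); last first.
  apply/funext => s /=; rewrite [LHS]integralE; congr (_ - _)%E;
    by apply: eq_integral => t _; rewrite ?funeposE ?funenegE.
apply: emeasurable_funB.
- apply: (@measurable_fun_fubini_tonelli_F _ _ _ _ _ m2 (EFin \o h)^\+%E) => //.
  exact: measurable_funepos.
- apply: (@measurable_fun_fubini_tonelli_F _ _ _ _ _ m2 (EFin \o h)^\-%E) => //.
  exact: measurable_funeneg.
Qed.

Lemma cmeasurable_cintegral_section (h : T1 * T2 -> R[i]) : cmeasurable h ->
  cmeasurable (fun s => cintegral m2 (fun t => h (s, t))).
Proof.
by move=> [hr hi]; split=> /=; [exact: (measurable_Rintegral_section hr)|
  exact: (measurable_Rintegral_section hi)].
Qed.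

Lemma cmeasurable_fst (a : T1 -> R[i]) : cmeasurable a ->
  cmeasurable (fun z : T1 * T2 => a z.1).
Proof.
move=> [ar ai]; split.
- exact: (measurableT_comp ar measurable_fst).
- exact: (measurableT_comp ai measurable_fst).
Qed.

Lemma cmeasurable_snd (b : T2 -> R[i]) : cmeasurable b ->
  cmeasurable (fun z : T1 * T2 => b z.2).
Proof.
move=> [ar ai]; split.
- exact: (measurableT_comp ar measurable_snd).
- exact: (measurableT_comp ai measurable_snd).
Qed.

Lemma cmeasurable_pair2 (h : T1 * T2 -> R[i]) s : cmeasurable h ->
  cmeasurable (fun t => h (s, t)).
Proof.
move=> [hr hi]; split.
- exact: (measurable_fun_pair2 s hr).
- exact: (measurable_fun_pair2 s hi).
Qed.

Lemma cmeasurable_pair1 (h : T1 * T2 -> R[i]) t : cmeasurable h ->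
  cmeasurable (fun s => h (s, t)).
Proof.
move=> [hr hi]; split.
- exact: (measurable_fun_pair1 t hr).
- exact: (measurable_fun_pair1 t hi).
Qed.

(** The sections are taken integrable everywhere, not only almost everywhere,
    so that [fine] can be removed from every inner integral. *)
Lemma cfubini12 (F : T1 * T2 -> R[i]) :
  cintegrable (m1 \x m2)%E F ->
  (forall s, cintegrable m2 (fun t => F (s, t))) ->
  cintegral (m1 \x m2)%E F =
  cintegral m1 (fun s => cintegral m2 (fun t => F (s, t))).
Proof.
move=> [Fr Fi] sec; apply: complex_eqP; rewrite /cintegral /=; congr fine.
- rewrite -(integral12_prod_meas1 Fr); apply: eq_integral => s _.
  rewrite /fubini_F /Rintegral fineK//; have [? _] := sec s.
  exact: integrable_fin_num.
- rewrite -(integral12_prod_meas1 Fi); apply: eq_integral => s _.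
  rewrite /fubini_F /Rintegral fineK//; have [_ ?] := sec s.
  exact: integrable_fin_num.
Qed.

Lemma cfubini21 (F : T1 * T2 -> R[i]) :
  cintegrable (m1 \x m2)%E F ->
  (forall t, cintegrable m1 (fun s => F (s, t))) ->
  cintegral (m1 \x m2)%E F =
  cintegral m2 (fun t => cintegral m1 (fun s => F (s, t))).
Proof.
move=> [Fr Fi] sec; apply: complex_eqP; rewrite /cintegral /=; congr fine.
- rewrite -(integral21_prod_meas1 Fr); apply: eq_integral => s _.
  rewrite /fubini_G /Rintegral fineK//; have [? _] := sec s.
  exact: integrable_fin_num.
- rewrite -(integral21_prod_meas1 Fi); apply: eq_integral => s _.
  rewrite /fubini_G /Rintegral fineK//; have [_ ?] := sec s.
  exact: integrable_fin_num.
Qed.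

Section bounded_kernel.
Variables (a : T1 -> R[i]) (b : T2 -> R[i]) (K : T1 * T2 -> R[i]) (M : R).
Hypotheses (ia : cintegrable m1 a) (ib : cintegrable m2 b).
Hypotheses (mK : cmeasurable K) (KM : forall z, normc (K z) <= M).

(** All exchanges of integrals in this development are of one form: an
    integrable tensor [a * b] against a bounded kernel [K], which is an
    exponential, possibly times a bounded symbol. *)
Lemma cintegrable_tensor :
  cintegrable (m1 \x m2)%E (fun z => a z.1 * b z.2 * K z).
Proof.
have ma := cintegrable_measurable ia; have mb := cintegrable_measurable ib.
have mab : cmeasurable (fun z : T1 * T2 => a z.1 * b z.2).
  by apply: cmeasurableM; [exact: cmeasurable_fst|exact: cmeasurable_snd].
apply: (@cintegrableMbounded _ _ _ _ _ _ M) => //.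
apply/cintegrableP; split => //.
have mnb : measurable_fun setT (fun t => (normc (b t))%:E).
  exact/measurable_EFinP/cmeasurable_normc.
have mna : measurable_fun setT (fun s => (normc (a s))%:E).
  exact/measurable_EFinP/cmeasurable_normc.
rewrite fubini_tonelli1//=; last 2 first.
- exact/measurable_EFinP/cmeasurable_normc.
- by move=> z; rewrite lee_fin normc_ge0.
rewrite /fubini_F /=.
under eq_integral => s _.
  under eq_integral do rewrite normcM EFinM.
  rewrite ge0_integralZl//; last 2 first.
  - by move=> *; rewrite lee_fin normc_ge0.
  - by rewrite lee_fin normc_ge0.
  over.
rewrite ge0_integralZr//; last 2 first.
- by move=> *; rewrite lee_fin normc_ge0.
- by apply: integral_ge0 => *; rewrite lee_fin normc_ge0.
move/cintegrableP : ia => [_ ia']; move/cintegrableP : ib => [_ ib'].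
have fa : (\int[m1]_x (normc (a x))%:E \is a fin_num)%E.
  by rewrite ge0_fin_numE//; apply: integral_ge0 => *; rewrite lee_fin normc_ge0.
have fb : (\int[m2]_x (normc (b x))%:E \is a fin_num)%E.
  by rewrite ge0_fin_numE//; apply: integral_ge0 => *; rewrite lee_fin normc_ge0.
by have := fin_numM fa fb; rewrite fin_numElt => /andP[].
Qed.

Lemma kernel_fubini12 :
  cintegral (m1 \x m2)%E (fun z => a z.1 * b z.2 * K z) =
  cintegral m1 (fun s => a s * cintegral m2 (fun t => b t * K (s, t))).
Proof.
have sec s : cintegrable m2 (fun t => b t * K (s, t)).
  by apply: (@cintegrableMbounded _ _ _ _ _ _ M) => //; exact: cmeasurable_pair2.
rewrite cfubini12/=; last 2 first.
- exact: cintegrable_tensor.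
- move=> s /=; under eq_fun do rewrite -mulrA; exact: cintegrableZ.
apply: eq_cintegral => s; under eq_fun do rewrite -mulrA.
by rewrite cintegralZl.
Qed.

Lemma kernel_fubini21 :
  cintegral (m1 \x m2)%E (fun z => a z.1 * b z.2 * K z) =
  cintegral m2 (fun t => b t * cintegral m1 (fun s => a s * K (s, t))).
Proof.
have sec t : cintegrable m1 (fun s => a s * K (s, t)).
  by apply: (@cintegrableMbounded _ _ _ _ _ _ M) => //; exact: cmeasurable_pair1.
have E s t : a s * b t * K (s, t) = b t * (a s * K (s, t)) by rewrite mulrCA mulrA.
rewrite cfubini21/=; last 2 first.
- exact: cintegrable_tensor.
- move=> t /=; under eq_fun do rewrite E; exact: cintegrableZ.
apply: eq_cintegral => t; under eq_fun do rewrite E.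
by rewrite cintegralZl.
Qed.

Lemma kernel_fubini :
  cintegral m1 (fun s => a s * cintegral m2 (fun t => b t * K (s, t))) =
  cintegral m2 (fun t => b t * cintegral m1 (fun s => a s * K (s, t))).
Proof. by rewrite -kernel_fubini12 kernel_fubini21. Qed.

End bounded_kernel.
End complex_fubini.

(** * Affine change of variables *)

Section affine_substitution.
Context (R : realType).
Local Notation mu := (@lebesgue_measure R).

Lemma measurable_affine (a b : R) :
  measurable_fun [set: measurableTypeR R] (fun x : measurableTypeR R => a * x + b : measurableTypeR R).
Proof. by apply: measurable_funD => //; exact: measurable_funM. Qed.

(** Uniqueness of Lebesgue measure: the scaled pushforward has the same values
    on the half-open intervals that generate the Borel sets.  For [a < 0] the
    preimage of such an interval is closed at the other end. *)
Lemma lebesgue_affine (a b : R) (A : set R) : a != 0 -> measurable A ->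
  mu A = (`|a|%:E * pushforward mu (fun x : measurableTypeR R => (a * x + b)%R : measurableTypeR R) A)%E.
Proof.
move=> a0 mA.
have na0 : 0 <= `|a| by [].
have := @lebesgue_measure_unique R (mscale (NngNum na0)
  (measure_function_pushforward__canonical__measure_function_Measure mu
     (measurable_affine a b))).
rewrite /mscale/=; apply => // _ [[u v] _ <-] /=.
rewrite -[RHS]/(`|a|%:E * mu ((fun x : R => (a * x + b)%R) @^-1` `]u, v]))%E.
have [a_lt0|a_gt0|a_eq0] := ltgtP a 0; last first.
- by rewrite a_eq0 eqxx in a0.
- rewrite (_ : _ @^-1` _ = `](u - b) / a, (v - b) / a]%classic); last first.
    apply/seteqP; split => x /=; rewrite !in_itv /= ltr_pdivrMr// ler_pdivlMr//;
      by rewrite ltrBlDr lerBrDr mulrC.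
  rewrite !lebesgue_measure_itv /= !lte_fin ltr_pM2r ?invr_gt0// ltrD2r.
  case: ifPn => _; last by rewrite mule0.
  rewrite -!EFinB -EFinM gtr0_norm//; congr (_%:E); by field.
- rewrite (_ : _ @^-1` _ = `[(v - b) / a, (u - b) / a[%classic); last first.
    apply/seteqP; split => x /=; rewrite !in_itv /= ltr_ndivlMr// ler_ndivrMr//;
      by rewrite ltrBlDr lerBrDr mulrC andbC.
  rewrite !lebesgue_measure_itv /= !lte_fin ltr_nM2r ?invr_lt0// ltrD2r.
  case: ifPn => _; last by rewrite mule0.
  rewrite -!EFinB -EFinM ltr0_norm//; congr (_%:E); by field.
Qed.

Lemma ge0_integral_affine (a b : R) (h : R -> \bar R) : a != 0 ->
  measurable_fun setT h -> (forall x, 0 <= h x)%E ->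
  (\int[mu]_x h x = `|a|%:E * \int[mu]_x h (a * x + b)%R)%E.
Proof.
move=> a0 mh h0; have na0 : 0 <= `|a| by [].
pose p := measure_function_pushforward__canonical__measure_function_Measure mu
     (measurable_affine a b).
transitivity (\int[mscale (NngNum na0) p]_x h x)%E.
  apply: eq_measure_integral => A mA _ /=; exact: lebesgue_affine.
rewrite ge0_integral_mscale//=; congr (_ * _)%E.
rewrite (ge0_integral_pushforward (measurable_affine a b) mu measurableT mh)//.
Qed.

Lemma integral_affine (a b : R) (h : R -> R) : a != 0 ->
  mu.-integrable setT (fun x => (h x)%:E) ->
  mu.-integrable setT (fun x => (h (a * x + b))%:E) /\
  \int[mu]_x h x = `|a| * \int[mu]_x h (a * x + b).
Proof.
move=> a0 ih; have /integrableP[mh hoo] := ih.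
have mh' : measurable_fun setT (fun x => (h (a * x + b))%:E).
  exact: (measurableT_comp mh (measurable_affine a b)).
have na0 : 0 < `|a| by rewrite normr_gt0.
have ih' : mu.-integrable setT (fun x => (h (a * x + b))%:E).
  apply/integrableP; split => //.
  move: hoo; rewrite (@ge0_integral_affine a b _ a0)//; last first.
    exact: measurableT_comp.
  by rewrite !ltey; apply: contra => /eqP ->; rewrite gt0_muley ?lte_fin.
split => //.
rewrite /Rintegral -[`|a|]/(fine (`|a|%:E)) -fineM//; last exact: integrable_fin_num.
congr fine.
rewrite integralE [in RHS]integralE.
rewrite (@ge0_integral_affine a b (_^\+)%E)//; last exact: measurable_funepos.
rewrite (@ge0_integral_affine a b (_^\-)%E)//; last exact: measurable_funeneg.
have E1 : ((fun x => (h (a * x + b))%:E)^\+ =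
           (fun x => (fun x => (h x)%:E)^\+ (a * x + b)%R))%E.
  by apply/funext => x; rewrite !funeposE.
have E2 : ((fun x => (h (a * x + b))%:E)^\- =
           (fun x => (fun x => (h x)%:E)^\- (a * x + b)%R))%E.
  by apply/funext => x; rewrite !funenegE.
rewrite E1 E2 -muleBr// -E1 -E2 fin_num_adde_defr//.
by apply: integrable_fin_num => //; exact: integrable_funepos.
Qed.

Lemma cintegrable_affine (a b : R) (f : R -> R[i]) : a != 0 ->
  cintegrable mu f -> cintegrable mu (fun x => f (a * x + b)).
Proof.
by move=> a0 [/(integral_affine b a0)[fr _] /(integral_affine b a0)[fi _]].
Qed.

Lemma cintegral_affine (a b : R) (f : R -> R[i]) : a != 0 -> cintegrable mu f ->
  cintegral mu f = (`|a|%:C * cintegral mu (fun x => f (a * x + b)))%R.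
Proof.
move=> a0 [/(integral_affine b a0)[_ fr] /(integral_affine b a0)[_ fi]].
by rewrite /cintegral fr fi; apply: complex_eqP; rewrite /= mul0r ?subr0 ?addr0.
Qed.

Lemma cmeasurable_affine (a b : R) (f : R -> R[i]) :
  cmeasurable (f : measurableTypeR R -> R[i]) ->
  cmeasurable (fun x : measurableTypeR R => f (a * x + b)).
Proof.
move=> [fr fi]; split.
- exact: (measurableT_comp fr (measurable_affine a b)).
- exact: (measurableT_comp fi (measurable_affine a b)).
Qed.

End affine_substitution.

(** * The Poisson and Abel kernels *)

Section poisson_kernel.
Context (R : realType).
Local Notation mu := (@lebesgue_measure R).

(** The Poisson kernel of the upper half-plane without its factor [1 / pi]; in
    particular [poisson 1 t] is the weight [1 / (1 + t^2)]. *)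
Definition poisson (e t : R) : R := e / (e ^+ 2 + t ^+ 2).

(** The Abel summation factor, used to regularize Fourier integrals: its own
    transform is elementary. *)
Definition abel (e u : R) : R := expR (- (e * `|u|)).

Lemma sqrD_gt0 (e t : R) : 0 < e -> 0 < e ^+ 2 + t ^+ 2.
Proof. by move=> e0; rewrite ltr_pwDl ?exprn_gt0 ?sqr_ge0. Qed.

Lemma poisson_ge0 (e t : R) : 0 < e -> 0 <= poisson e t.
Proof. by move=> e0; rewrite /poisson divr_ge0 ?ltW ?sqrD_gt0. Qed.

Lemma poisson_le (e t : R) : 0 < e -> poisson e t <= e^-1.
Proof.
move=> e0; rewrite /poisson ler_pdivrMr ?sqrD_gt0// mulrDr expr2 mulrA mulVf ?gt_eqF//.
by rewrite mul1r lerDl mulr_ge0 ?invr_ge0 ?(ltW e0) ?sqr_ge0.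
Qed.

Lemma continuous_poisson (e : R) : 0 < e -> continuous (poisson e).
Proof.
move=> e0 t; rewrite /poisson; apply: cvgM; first exact: cvg_cst.
apply: cvgV; first by rewrite gt_eqF ?sqrD_gt0.
by apply: cvgD; [exact: cvg_cst|exact: exprn_continuous].
Qed.

Lemma continuous_abel (e : R) : continuous (abel e).
Proof.
move=> u; rewrite /abel; apply: (@continuous_comp _ _ _ (fun u : R => - (e * `|u|)) expR).
  by apply: cvgN; apply: cvgM; [exact: cvg_cst|exact: norm_continuous].
exact: continuous_expR.
Qed.

Lemma integral_poisson (e : R) : 0 < e ->
  (\int[mu]_t (poisson e t)%:E = (pi)%:E)%E.
Proof.
move=> e0.
rewrite ge0_symfun_integralT; last 3 first.
- by move=> t; exact: poisson_ge0.
- exact: continuous_poisson.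
- by move=> t; rewrite /poisson /= sqrrN.
rewrite (_ : [set x : R | 0 <= x] = `[0, +oo[%classic); last first.
  by apply/seteqP; split => x /=; rewrite in_itv/= andbT.
have dF (x : R) : is_derive x 1 (fun t : R => atan (t / e)) (poisson e x).
  apply: is_derive_eq.
  rewrite /poisson /GRing.scale /=; have := sqrD_gt0 x e0; move: e0 => e1 e2.
  by field; rewrite ?gt_eqF.
rewrite (@ge0_continuous_FTC2y R _ (fun t => atan (t / e)) 0 (pi / 2)).
- rewrite mul0r atan0 sube0 -EFinM; congr (_%:E); by field.
- by move=> x _; exact: poisson_ge0.
- by apply: continuous_subspaceT; exact: continuous_poisson.
- apply: (cvg_comp (fun t : R => t / e) atan); last exact: cvgy_atan.
  by apply: gt0_cvgMly => //; rewrite invr_gt0.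
- by move=> x _; exact: ex_derive.
- apply: cvg_at_right_filter; apply: differentiable_continuous.
  by apply/derivable1_diffP; exact: ex_derive.
- by move=> x _; rewrite derive1E derive_val.
Qed.

(** Adding the constant 1 to the cosine makes the integrand nonnegative, which
    allows integration over the half-line by a primitive; the contribution of
    the constant is subtracted in [cintegral_abel]. *)
Lemma integral_abel_cos1 (e t : R) : 0 < e ->
  (\int[mu]_u (abel e u * (1 + cos (u * t)))%:E = (2 * (e^-1 + poisson e t))%:E)%E.
Proof.
move=> e0.
have cabel : continuous (fun u => abel e u * (1 + cos (u * t))).
  move=> u; apply: cvgM; first exact: continuous_abel.
  apply: cvgD; first exact: cvg_cst.
  apply: (@continuous_comp _ _ _ (fun u : R => u * t) cos); last exact: continuous_cos.
  exact: mulrr_continuous.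
rewrite (@ge0_symfun_integralT R (fun u => abel e u * (1 + cos (u * t)))); last 3 first.
- by move=> u; rewrite mulr_ge0 ?expR_ge0// -lerBlDl sub0r cos_geN1.
- exact: cabel.
- by move=> u; rewrite /abel /= normrN mulNr cosN.
rewrite (_ : [set x : R | 0 <= x] = `[0, +oo[%classic); last first.
  by apply/seteqP; split => x /=; rewrite in_itv/= andbT.
(* A primitive of exp(-e u) (1 + cos (u t)) on the half-line u >= 0. *)
pose F u : R := - (expR (- (e * u)) / e) +
  expR (- (e * u)) * (t * sin (u * t) - e * cos (u * t)) / (e ^+ 2 + t ^+ 2).
have dF (x : R) : is_derive x 1 F (expR (- (e * x)) * (1 + cos (x * t))).
  rewrite /F; apply: is_derive_eq; rewrite /GRing.scale /=.
  have := sqrD_gt0 t e0; move: e0 => e1 e2.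
  by field; rewrite ?gt_eqF.
have cexp : expR (- (e * u)) @[u --> +oo%R] --> 0.
  apply: (cvg_comp (fun u : R => e * u) (fun v => expR (- v))); last exact: cvgr_expR.
  exact: gt0_cvgMry.
rewrite (@ge0_continuous_FTC2y R _ F 0 0).
- rewrite /F /poisson !mul0r mulr0 oppr0 expR0 sin0 cos0 -EFinM; congr (_%:E).
  have := sqrD_gt0 t e0; move: e0 => e1 e2.
  by field; rewrite ?gt_eqF.
- by move=> x _; rewrite mulr_ge0 ?expR_ge0// -lerBlDl sub0r cos_geN1.
- by apply: continuous_subspaceT; exact: cabel.
- pose C := e^-1 + (`|t| + e) / (e ^+ 2 + t ^+ 2).
  have FC u : `|F u| <= expR (- (e * u)) * C.
    rewrite /F /C [leRHS]mulrDr; apply: le_trans (ler_normD _ _) _; apply: lerD.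
      by rewrite normrN normrM !gtr0_norm ?expR_gt0 ?invr_gt0.
    rewrite !normrM (gtr0_norm (expR_gt0 _)) mulrA normfV (gtr0_norm (sqrD_gt0 t e0)).
    rewrite ler_pM2r ?invr_gt0 ?sqrD_gt0// ler_pM2l ?expR_gt0//.
    apply: le_trans (ler_normB _ _) _; rewrite !normrM (gtr0_norm e0).
    apply: lerD.
      by rewrite ler_piMr// ler_norml sin_geN1 sin_le1.
    by rewrite ler_piMr ?(ltW e0)// ler_norml cos_geN1 cos_le1.
  have cC : expR (- (e * u)) * C @[u --> +oo%R] --> 0.
    by rewrite -[X in _ --> X](mul0r C); apply: cvgM => //; exact: cvg_cst.
  apply: (@squeeze_cvgr _ _ _ _ (fun u => - (expR (- (e * u)) * C)) (fun u => expR (- (e * u)) * C)) => //.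
    by apply: nearW => u; rewrite -ler_norml.
  by rewrite -oppr0; exact: cvgN.
- by move=> x _; exact: ex_derive.
- apply: cvg_at_right_filter; apply: differentiable_continuous.
  by apply/derivable1_diffP; exact: ex_derive.
- move=> x; rewrite in_itv/= andbT => x0.
  by rewrite derive1E derive_val /abel gtr0_norm.
Qed.

Lemma measurable_abel (e : R) : measurable_fun setT (abel e).
Proof. by apply: continuous_measurable_fun; exact: continuous_abel. Qed.

Lemma measurable_poisson (e : R) : 0 < e -> measurable_fun setT (poisson e).
Proof. by move=> e0; apply: continuous_measurable_fun; exact: continuous_poisson. Qed.

Lemma integral_abel (e : R) : 0 < e ->
  (\int[mu]_u (abel e u)%:E = (2 / e)%:E)%E.
Proof.
move=> e0; have := integral_abel_cos1 0 e0.
under eq_integral do rewrite mulr0 cos0 mulrC EFinM.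
rewrite ge0_integralZl_EFin//; last 2 first.
- by move=> u _; rewrite lee_fin expR_ge0.
- by apply/measurable_EFinP; exact: measurable_abel.
move=> H.
have -> : (2 / e)%:E = (2^-1%:E * (2 * (e^-1 + poisson e 0))%:E)%E.
  rewrite -EFinM; congr (_%:E); rewrite /poisson expr0n addr0.
  by field; rewrite gt_eqF.
by rewrite -H muleA -EFinM [X in (_ * X)%:E](_ : _ = 2)// mulVf// mul1e.
Qed.

Lemma integrable_abel (e : R) : 0 < e ->
  mu.-integrable setT (fun u => (abel e u)%:E).
Proof.
move=> e0; apply/integrableP; split.
  by apply/measurable_EFinP; exact: measurable_abel.
under eq_integral do rewrite /= ger0_norm ?expR_ge0//.
by rewrite integral_abel// ltry.
Qed.

Lemma integrable_poisson (e : R) : 0 < e ->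
  mu.-integrable setT (fun u => (poisson e u)%:E).
Proof.
move=> e0; apply/integrableP; split.
  by apply/measurable_EFinP; exact: measurable_poisson.
under eq_integral do rewrite /= ger0_norm ?poisson_ge0//.
by rewrite integral_poisson// ltry.
Qed.

Lemma ger0_normc (r : R) : 0 <= r -> normc (r%:C) = r.
Proof. by move=> r0; rewrite normcR ger0_norm. Qed.

Lemma normc_poisson (e t : R) : 0 < e -> normc ((2 * poisson e t)%:C) = 2 * poisson e t.
Proof. by move=> e0; rewrite ger0_normc// mulr_ge0// poisson_ge0. Qed.

Lemma normc_poisson_le (e t : R) : 0 < e -> normc ((2 * poisson e t)%:C) <= 2 / e.
Proof. by move=> e0; rewrite normc_poisson// ler_wpM2l// poisson_le. Qed.

Lemma cintegrable_abel (e : R) : 0 < e -> cintegrable mu (fun u => (abel e u)%:C).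
Proof.
move=> e0; split; first exact: integrable_abel.
exact: integrable0.
Qed.

Lemma normc_expi (t : R) : normc (expi t) = 1.
Proof. by rewrite /expi /= cos2Dsin2 sqrtr1. Qed.

Lemma expiD (s t : R) : expi (s + t) = expi s * expi t.
Proof. by rewrite /expi cosD sinD; apply: complex_eqP; rewrite /= ?ImM ?ReM /=; ring. Qed.

Lemma conjc_expi (t : R) : conjc (expi t) = expi (- t).
Proof. by rewrite /expi cosN sinN. Qed.

(** The cosine part is [integral_abel_cos1]; the sine part vanishes by
    parity. *)
Lemma cintegral_abel (e t : R) : 0 < e ->
  cintegral mu (fun u => (abel e u)%:C * expi (u * t)) = (2 * poisson e t)%:C.
Proof.
move=> e0.
have ca : cintegrable mu (fun u => (abel e u)%:C * expi (u * t)).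
  apply: (@cintegrableMbounded _ _ _ _ _ _ 1).
  - exact: cintegrable_abel.
  - by apply: cmeasurable_expi; exact: measurable_funM.
  - by move=> u; rewrite normc_expi.
have [ir ii] := ca.
apply: complex_eqP => /=.
- have E : \int[mu]_u (abel e u * (1 + cos (u * t))) = 2 * (e^-1 + poisson e t).
    by rewrite /Rintegral integral_abel_cos1.
  have E2 : \int[mu]_u (abel e u * (1 + cos (u * t))) = 2 / e +
      \int[mu]_u complex.Re ((abel e u)%:C * expi (u * t)).
    under eq_Rintegral do rewrite mulrDr mulr1.
    rewrite RintegralD//; last 2 first.
    - exact: integrable_abel.
    - by move: ir; under eq_fun do rewrite ReM /= mul0r subr0.
    rewrite {1}/Rintegral integral_abel//=; congr (_ + _).
    by apply: eq_Rintegral => u _; rewrite mul0r subr0.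
  move: E; rewrite E2 mulrDr => /addrI <-; apply: eq_Rintegral => u _.
  by rewrite ReM.
- have N1 : (-1 : R) != 0 by rewrite oppr_eq0 oner_eq0.
  have H := (integral_affine 0 N1 ii).2.
  (* The substitution u -> - u turns the imaginary part into its opposite. *)
  set I := LHS; have {H} : I = - I; last by lra.
  rewrite {1}/I; rewrite normrN normr1 mul1r in H; apply: etrans H _.
  rewrite -[RHS]mulN1r -RintegralZl//; apply: eq_Rintegral => u _.
  by rewrite ImM /= !mul0r !addr0 !mulN1r /abel normrN mulNr sinN mulrN.
Qed.

End poisson_kernel.

(** * The Fourier transform and its inversion *)

Section fourier_theory.
Context (R : realType).
Local Notation mu := (@lebesgue_measure R).
Implicit Types f : R -> R[i].

Lemma cmeasurable_fourier_kernel :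
  cmeasurable (fun z : measurableTypeR R * measurableTypeR R => expi (- (z.2 * z.1))).
Proof. by apply: cmeasurable_expi; apply: measurableT_comp => //; exact: measurable_funM. Qed.

Lemma cmeasurable_fourier f : cmeasurable (f : measurableTypeR R -> R[i]) ->
  cmeasurable (fourier f : measurableTypeR R -> R[i]).
Proof.
move=> mf; rewrite /fourier.
apply: (@cmeasurable_cintegral_section _ _ _ _ _ mu
  (fun z : measurableTypeR R * measurableTypeR R => f z.2 * expi (- (z.2 * z.1)))).
apply: cmeasurableM; first exact: cmeasurable_snd.
exact: cmeasurable_fourier_kernel.
Qed.

Lemma cintegrable_mul_expi f (h : R -> R) : cintegrable mu f ->
  measurable_fun setT h -> cintegrable mu (fun x => f x * expi (h x)).
Proof.
move=> fi mh; apply: (@cintegrableMbounded _ _ _ _ _ _ 1) => //.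
- exact: cmeasurable_expi.
- by move=> x; rewrite normc_expi.
Qed.

Lemma cintegrable_fourier_integrand f xi : cintegrable mu f ->
  cintegrable mu (fun x => f x * expi (- (x * xi))).
Proof.
move=> fi; apply: cintegrable_mul_expi => //.
by apply: measurableT_comp => //; exact: measurable_funM.
Qed.

Lemma normc_fourier_le f xi : cintegrable mu f ->
  ((normc (fourier f xi))%:E <= \int[mu]_x (normc (f x))%:E)%E.
Proof.
move=> fi; apply: le_trans (normc_cintegral_le _ _) _.
  exact: cintegrable_measurable (cintegrable_fourier_integrand xi fi).
by under eq_integral do rewrite normcM normc_expi mulr1.
Qed.

Lemma fourier_bounded f : cintegrable mu f ->
  exists M, forall xi, normc (fourier f xi) <= M.
Proof.
move=> fi; exists (fine (\int[mu]_x (normc (f x))%:E)) => xi.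
rewrite -lee_fin fineK; first exact: normc_fourier_le.
by apply: integrable_fin_num => //; exact: cintegrable_normc.
Qed.

(** Fubini, the kernel [exp(-ist)] being symmetric in [s] and [t]. *)
Lemma fourier_multiplication f g : cintegrable mu f -> cintegrable mu g ->
  cintegral mu (fun s => g s * fourier f s) = cintegral mu (fun t => f t * fourier g t).
Proof.
move=> fi gi.
have K1 (z : measurableTypeR R * measurableTypeR R) : normc (expi (- (z.2 * z.1))) <= 1.
  by rewrite normc_expi.
rewrite /fourier; apply: etrans (kernel_fubini gi fi cmeasurable_fourier_kernel K1) _.
by apply: eq_cintegral => t; congr (_ * _); apply: eq_cintegral => s /=;
  congr (_ * expi (- _)); rewrite mulrC.
Qed.

(** The exchange formula applied to [f] and to the Abel factor modulated by
    [exp(ix xi)], whose transform is the Poisson kernel centred at [x]. *)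
Lemma abel_mean f (e x : R) : 0 < e -> cintegrable mu f ->
  cintegral mu (fun xi => fourier f xi * ((abel e xi)%:C * expi (x * xi))) =
  cintegral mu (fun y => f y * (2 * poisson e (x - y))%:C).
Proof.
move=> e0 fi.
have ai : cintegrable mu (fun xi => (abel e xi)%:C * expi (x * xi)).
  apply: cintegrable_mul_expi; first exact: cintegrable_abel.
  exact: measurable_funM.
under eq_cintegral do rewrite mulrC.
rewrite fourier_multiplication//; apply: eq_cintegral => y; congr (_ * _).
rewrite -cintegral_abel// /fourier; apply: eq_cintegral => xi.
by rewrite -mulrA -expiD; congr (_ * expi _); ring.
Qed.

(** Let [e -> 0] in [abel_mean].  The left-hand side tends to the inversion
    integral because [fourier f] is integrable.  On the right the substitution
    [y = e s + x] moves the dependence on [e] into the argument of [f], which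
    tends to [x]; boundedness of [f] gives the domination. *)
Lemma fourier_inversion f M x : cintegrable mu f -> cintegrable mu (fourier f) ->
  continuous (fun y => complex.Re (f y)) -> continuous (fun y => complex.Im (f y)) ->
  (forall y, normc (f y) <= M) ->
  cintegral mu (fun xi => fourier f xi * expi (x * xi)) = (2 * pi)%:C * f x.
Proof.
move=> fi ffi cr ci fM.
have mf := cintegrable_measurable fi.
have mff := cintegrable_measurable ffi.
pose e (n : nat) : R := n.+1%:R^-1.
have e0 n : 0 < e n by rewrite invr_gt0.
have cve : e n @[n --> \oo] --> 0 by exact: cvg_harmonic.
pose G n xi := fourier f xi * ((abel (e n) xi)%:C * expi (x * xi)).
pose H n s := f (e n * s + x) * (2 * poisson 1 s)%:C.
have mexp : cmeasurable (fun xi : measurableTypeR R => expi (x * xi)).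
  by apply: cmeasurable_expi; exact: measurable_funM.
have mG n : cmeasurable (G n : measurableTypeR R -> _).
  apply: cmeasurableM => //; apply: cmeasurableM => //.
  by apply: cmeasurable_real; exact: measurable_abel.
have mp2 : measurable_fun setT (fun s : R => 2 * poisson 1 s).
  by apply: measurable_funM => //; exact: measurable_poisson.
have mH n : cmeasurable (H n : measurableTypeR R -> _).
  apply: cmeasurableM; first exact: cmeasurable_affine.
  exact: cmeasurable_real.
have GH n : cintegral mu (G n) = cintegral mu (H n).
  rewrite /G abel_mean//.
  rewrite (@cintegral_affine _ (e n) x) ?gt_eqF//; last first.
    apply: (@cintegrableMbounded _ _ _ _ _ _ (2 / e n)) => //.
      apply: cmeasurable_real; apply: measurable_funM => //.
      apply: (@measurableT_comp _ _ _ _ _ _ (poisson (e n))).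
        exact: measurable_poisson.
      exact: measurable_funB.
    by move=> y; exact: normc_poisson_le.
  rewrite gtr0_norm// -cintegralZl; last first.
    apply: (@cintegrableMbounded _ _ _ _ _ _ (2 / e n)) => //.
    - by apply: cintegrable_affine; rewrite ?gt_eqF.
    - apply: cmeasurable_real; apply: measurable_funM => //.
      rewrite (_ : (fun y => _) = (fun y => poisson (e n) (- e n * y + 0))).
        apply: (@measurableT_comp _ _ _ _ _ _ (poisson (e n))).
          exact: measurable_poisson.
        exact: measurable_affine.
      by apply/funext => y; congr poisson; ring.
    - by move=> y; exact: normc_poisson_le.
  apply: eq_cintegral => s; rewrite /H mulrCA; congr (_ * _).
  rewrite -rmorphM /=; congr (_%:C); rewrite /poisson.
  have := sqrD_gt0 s (@ltr01 R); have := sqrD_gt0 (x - (e n * s + x)) (e0 n).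
  move: (e0 n) => e1 e2 e3; field.
  by rewrite expr1n in e3; apply/andP; split; rewrite gt_eqF.
have [Gr Gi] : complex.Re (cintegral mu (G n)) @[n --> \oo] -->
      complex.Re (cintegral mu (fun xi => fourier f xi * expi (x * xi))) /\
    complex.Im (cintegral mu (G n)) @[n --> \oo] -->
      complex.Im (cintegral mu (fun xi => fourier f xi * expi (x * xi))).
  have abel1 n xi : abel (e n) xi <= 1.
    by rewrite /abel -expR0 ler_expR oppr_le0 mulr_ge0// ltW.
  have cvabel xi : abel (e n) xi @[n --> \oo] --> (1 : R).
    rewrite /abel -expR0; apply: continuous_cvg; first exact: continuous_expR.
    rewrite -[X in _ --> X]oppr0; apply: cvgN; rewrite -[X in _ --> X](mul0r `|xi|).
    by apply: cvgM => //; exact: cvg_cst.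
  apply: (@cdominated_convergence _ _ _ mu G _ (fun xi => normc (fourier f xi))) => //.
  - exact: cmeasurableM.
  - exact: cintegrable_normc.
  - move=> n xi; rewrite /G !normcM normc_expi mulr1 normcR ger0_norm ?expR_ge0//.
    by rewrite ler_piMr// normc_ge0.
  - move=> xi; rewrite -[X in _ --> X]mul1r.
    rewrite (_ : (fun n => _) = (fun n => abel (e n) xi * complex.Re (fourier f xi * expi (x * xi)))).
      by apply: cvgM => //; exact: cvg_cst.
    by apply/funext => n; rewrite /G mulrCA ReZ.
  - move=> xi; rewrite -[X in _ --> X]mul1r.
    rewrite (_ : (fun n => _) = (fun n => abel (e n) xi * complex.Im (fourier f xi * expi (x * xi)))).
      by apply: cvgM => //; exact: cvg_cst.
    by apply/funext => n; rewrite /G mulrCA ImZ.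
have [Hr Hi] : complex.Re (cintegral mu (H n)) @[n --> \oo] -->
      complex.Re (cintegral mu (fun s => f x * (2 * poisson 1 s)%:C)) /\
    complex.Im (cintegral mu (H n)) @[n --> \oo] -->
      complex.Im (cintegral mu (fun s => f x * (2 * poisson 1 s)%:C)).
  have cva s : e n * s + x @[n --> \oo] --> x.
    rewrite -[X in _ --> X]add0r; apply: cvgD; last exact: cvg_cst.
    by rewrite -[X in _ --> X](mul0r s); apply: cvgM => //; exact: cvg_cst.
  apply: (@cdominated_convergence _ _ _ mu H _ (fun s => M * (2 * poisson 1 s))) => //.
  - by apply: cmeasurableM; [exact: cmeasurable_cst|exact: cmeasurable_real].
  - by do 2 apply: integrable_scale; exact: integrable_poisson.
  - move=> n s; rewrite /H normcM normc_poisson//.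
    by rewrite ler_wpM2r// mulr_ge0// poisson_ge0.
  - move=> s; rewrite mulrC ReZ.
    rewrite (_ : (fun n => _) = (fun n => 2 * poisson 1 s * complex.Re (f (e n * s + x)))).
      apply: cvgM; first exact: cvg_cst.
      exact: (continuous_cvg _ (cr x) (cva s)).
    by apply/funext => n; rewrite /H mulrC ReZ.
  - move=> s; rewrite mulrC ImZ.
    rewrite (_ : (fun n => _) = (fun n => 2 * poisson 1 s * complex.Im (f (e n * s + x)))).
      apply: cvgM; first exact: cvg_cst.
      exact: (continuous_cvg _ (ci x) (cva s)).
    by apply/funext => n; rewrite /H mulrC ImZ.
have -> : (2 * pi)%:C * f x = cintegral mu (fun s => f x * (2 * poisson 1 s)%:C).
  have ip : mu.-integrable setT (fun s : R => (poisson 1 s)%:E) by exact: integrable_poisson.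
  rewrite cintegralZl; last by split; [exact: (integrable_scale 2 ip)|exact: integrable0].
  rewrite mulrC; congr (_ * _); apply: complex_eqP => /=.
    by rewrite RintegralZl// /Rintegral integral_poisson.
  by rewrite /Rintegral integral0.
apply: complex_eqP.
- apply: (cvg_unique (@Rhausdorff R) Gr).
  by rewrite (_ : (fun n => complex.Re (cintegral mu (G n))) = (fun n => complex.Re (cintegral mu (H n))))//; apply/funext => n; rewrite GH.
- apply: (cvg_unique (@Rhausdorff R) Gi).
  by rewrite (_ : (fun n => complex.Im (cintegral mu (G n))) = (fun n => complex.Im (cintegral mu (H n))))//; apply/funext => n; rewrite GH.
Qed.

End fourier_theory.

(** * An L2 bound for the Fourier transform *)

Section bessel.
Context (R : realType).
Local Notation mu := (@lebesgue_measure R).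

Lemma measurable_subRR :
  measurable_fun setT (fun z : measurableTypeR R * measurableTypeR R => (z.1 - z.2)%R : measurableTypeR R).
Proof. exact: measurable_funB. Qed.

Lemma emeasurable_fst (h : R -> \bar R) : measurable_fun setT h ->
  measurable_fun setT (fun z : measurableTypeR R * measurableTypeR R => h z.1).
Proof. by move=> mh; exact: (measurableT_comp mh measurable_fst). Qed.

Lemma emeasurable_snd (h : R -> \bar R) : measurable_fun setT h ->
  measurable_fun setT (fun z : measurableTypeR R * measurableTypeR R => h z.2).
Proof. by move=> mh; exact: (measurableT_comp mh measurable_snd). Qed.

Lemma measurable_integral_section (F : R -> R -> \bar R) :
  measurable_fun setT (fun z : measurableTypeR R * measurableTypeR R => F z.1 z.2) ->
  (forall x y, 0 <= F x y)%E -> measurable_fun setT (fun x => \int[mu]_y F x y)%E.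
Proof.
move=> mF F0.
by apply: (@measurable_fun_fubini_tonelli_F _ _ _ _ _ mu (fun z => F z.1 z.2)).
Qed.

Lemma integral_convolution (h k : R -> \bar R) :
  measurable_fun setT h -> measurable_fun setT k ->
  (forall x, 0 <= h x)%E -> (forall x, 0 <= k x)%E ->
  (\int[mu]_s \int[mu]_y (h y * k (s - y)%R) =
   (\int[mu]_x h x) * (\int[mu]_x k x))%E.
Proof.
move=> mh mk h0 k0.
have mhk : measurable_fun setT
    (fun z : measurableTypeR R * measurableTypeR R => h z.2 * k (z.1 - z.2)%R)%E.
  apply: emeasurable_funM; first exact: emeasurable_snd.
  exact: (measurableT_comp mk measurable_subRR).
rewrite (@fubini_tonelli _ _ _ _ _ mu mu (fun z => h z.2 * k (z.1 - z.2)%R)%E)//=; last first.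
  by move=> z; exact: mule_ge0.
have ks y : (\int[mu]_s k (s - y)%R = \int[mu]_x k x)%E.
  rewrite [RHS](@ge0_integral_affine _ 1 (- y))// normr1 mul1e.
  by apply: eq_integral => s _; rewrite mul1r.
under eq_integral => y _.
  rewrite ge0_integralZl//; last first.
    by apply: (measurableT_comp mk); exact: measurable_funB.
  rewrite ks; over.
rewrite ge0_integralZr//; exact: integral_ge0.
Qed.

Lemma measurable_poissonB (e s : R) : 0 < e ->
  measurable_fun setT (fun y : R => poisson e (s - y)).
Proof.
move=> e0; apply: (@measurableT_comp _ _ _ _ _ _ (poisson e)).
  exact: measurable_poisson.
exact: measurable_funB.
Qed.

Lemma mulr_conjc (z : R[i]) : conjc z * z = (normc z ^+ 2)%:C.
Proof.
rewrite sqr_normcE; case: z => a b; apply: complex_eqP; rewrite /= ?ReM ?ImM /=; ring.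
Qed.

(** Since [fourier H] need not be square integrable a priori, its square is
    first weighted by the Abel factor.  The exchange formula rewrites the
    integral as the quadratic form with kernel [2 * poisson e (s - y)], and
    Schur's test, that is
      [2 |H s| |H y| <= |H s|^2 + |H y|^2],
    bounds it by the total mass [2 pi] of the kernel.  The right-hand side may
    be infinite. *)
Lemma bessel_abel (H : R -> R[i]) (e : R) : 0 < e -> cintegrable mu H ->
  (\int[mu]_u (abel e u * normc (fourier H u) ^+ 2)%:E <=
   (2 * pi)%:E * \int[mu]_s (normc (H s) ^+ 2)%:E)%E.
Proof.
move=> e0 iH.
have [M FM] := fourier_bounded iH.
have mH := cintegrable_measurable iH.
have mF := cmeasurable_fourier mH.
(* a * fourier H is the weighted square, so its integral is the left-hand side. *)
pose a u : R[i] := (abel e u)%:C * conjc (fourier H u).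
have ia : cintegrable mu a.
  apply: (@cintegrableMbounded _ _ _ _ _ _ M); first exact: cintegrable_abel.
    exact: cmeasurable_conj.
  by move=> u; rewrite normc_conjc.
have mFa := cmeasurable_fourier (cintegrable_measurable ia).
have aE u : a u * fourier H u = (abel e u * normc (fourier H u) ^+ 2)%:C.
  by rewrite /a -mulrA mulr_conjc -rmorphM.
have iaF : cintegrable mu (fun u => a u * fourier H u).
  by apply: (@cintegrableMbounded _ _ _ _ _ _ M).
have faE s : fourier a s = conjc (cintegral mu (fun y => H y * (2 * poisson e (s - y))%:C)).
  rewrite -abel_mean// -cintegral_conj; last first.
    under eq_fun do rewrite mulrC.
    apply: (@cintegrableMbounded _ _ _ _ _ _ M) => //.
    by apply: cintegrable_mul_expi; [exact: cintegrable_abel|exact: measurable_funM].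
  apply: eq_cintegral => u; rewrite !conjcM conjc_expi conjcR /a [RHS]mulrCA mulrA.
  by rewrite (mulrC s).
have mn : measurable_fun setT (fun s => (normc (H s))%:E).
  by apply/measurable_EFinP; exact: cmeasurable_normc.
have mn2 : measurable_fun setT (fun s => (normc (H s) ^+ 2)%:E).
  by apply/measurable_EFinP; apply: measurable_funX; exact: cmeasurable_normc.
have mp : measurable_fun setT (fun s => (poisson e s)%:E).
  by apply/measurable_EFinP; exact: measurable_poisson.
have fale s : ((normc (fourier a s))%:E <=
    \int[mu]_y (normc (H y) * (2 * poisson e (s - y)))%:E)%E.
  rewrite faE normc_conjc; apply: le_trans (normc_cintegral_le _ _) _.
    apply: cmeasurableM => //; apply: cmeasurable_real; apply: measurable_funM => //.
    exact: measurable_poissonB.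
  by under eq_integral do rewrite normcM normc_poisson//.
have -> : (\int[mu]_u (abel e u * normc (fourier H u) ^+ 2)%:E =
           (normc (cintegral mu (fun u => a u * fourier H u)))%:E)%E.
  have -> : cintegral mu (fun u => a u * fourier H u) =
      (\int[mu]_u (abel e u * normc (fourier H u) ^+ 2))%:C.
    by under eq_cintegral do rewrite aE; rewrite cintegral_real.
  rewrite normcR ger0_norm; last first.
    by apply: Rintegral_ge0 => u _; rewrite mulr_ge0 ?expR_ge0 ?sqr_ge0.
  rewrite /Rintegral fineK//; apply: integrable_fin_num => //.
  have [+ _] := iaF; congr (_.-integrable _ _).
  by apply/funext => u; rewrite aE /=.
rewrite fourier_multiplication//.
apply: le_trans (normc_cintegral_le _ _) _.
  exact: cmeasurableM.
(* The two terms given by the arithmetic-geometric inequality. *)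
pose G s y := ((normc (H s) ^+ 2)%:E * (poisson e (s - y))%:E +
               (normc (H y) ^+ 2)%:E * (poisson e (s - y))%:E)%E.
have mps (s : R) : measurable_fun setT (fun y : R => (poisson e (s - y))%:E).
  by apply/measurable_EFinP; exact: measurable_poissonB.
have p0 (s y : R) : (0 <= (poisson e (s - y))%:E)%E by rewrite lee_fin poisson_ge0.
have n0 s : (0 <= (normc (H s) ^+ 2)%:E)%E by rewrite lee_fin sqr_ge0.
have nHp0 (s y : R) : (0 <= (normc (H y) * (2 * poisson e (s - y)))%:E)%E.
  rewrite lee_fin; apply: mulr_ge0; first exact: normc_ge0.
  by apply: mulr_ge0 => //; exact: poisson_ge0.
have mps2 : measurable_fun setT
    (fun z : measurableTypeR R * measurableTypeR R => (poisson e (z.1 - z.2))%:E).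
  exact: (measurableT_comp mp measurable_subRR).
apply: (@le_trans _ _ (\int[mu]_s \int[mu]_y G s y)%E).
  apply: ge0_le_integral => //.
  - by move=> s _; rewrite lee_fin normc_ge0.
  - apply/measurable_EFinP; apply: cmeasurable_normc; exact: cmeasurableM.
  - apply: (@measurable_fun_fubini_tonelli_F _ _ _ _ _ mu (fun z => G z.1 z.2)); last first.
      by move=> z; rewrite adde_ge0// mule_ge0.
    apply: emeasurable_funD; apply: emeasurable_funM => //.
      exact: (emeasurable_fst mn2).
    exact: (emeasurable_snd mn2).
  - move=> s _; rewrite normcM EFinM.
    apply: (@le_trans _ _ ((normc (H s))%:E * \int[mu]_y (normc (H y) * (2 * poisson e (s - y)))%:E)%E).
      by apply: lee_wpmul2l => //; rewrite lee_fin normc_ge0.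
    have mHp : measurable_fun setT (fun y => (normc (H y) * (2 * poisson e (s - y)))%:E).
      apply/measurable_EFinP; apply: measurable_funM; first exact: cmeasurable_normc.
      by apply: measurable_funM => //; exact: measurable_poissonB.
    have nHs : (0 <= (normc (H s))%:E)%E by rewrite lee_fin normc_ge0.
    rewrite -ge0_integralZl//; apply: ge0_le_integral => //.
    + by move=> y _; rewrite mule_ge0.
    + exact: measurable_funeM.
    + apply: emeasurable_funD; first by apply: measurable_funeM; exact: (mps s).
      by apply: emeasurable_funM; [exact: mn2|exact: (mps s)].
    + move=> y _; rewrite /G -!EFinM -EFinD lee_fin -mulrDl.
      rewrite [leLHS](_ : _ = 2 * (normc (H s) * normc (H y)) * poisson e (s - y)); last by ring.
      apply: ler_wpM2r; first exact: poisson_ge0.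
      by have := sqr_ge0 (normc (H s) - normc (H y)); lra.
under eq_integral => s _.
  rewrite ge0_integralD//; last 4 first.
  - by move=> y _; rewrite mule_ge0.
  - by apply: measurable_funeM; exact: (mps s).
  - by move=> y _; rewrite mule_ge0.
  - by apply: emeasurable_funM; [exact: mn2|exact: (mps s)].
  rewrite ge0_integralZl//; last exact: (mps s).
  have -> : (\int[mu]_y (poisson e (s - y))%:E = pi%:E)%E.
    rewrite -(integral_poisson e0) (@ge0_integral_affine _ (-1) s (fun y => (poisson e y)%:E))//.
    - rewrite normrN normr1 mul1e; apply: eq_integral => y _.
      by congr (poisson e _)%:E; ring.
    - by move=> y; rewrite lee_fin poisson_ge0.
  over.
rewrite ge0_integralD//; last 4 first.
- by move=> s _; rewrite mule_ge0// lee_fin pi_ge0.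
- by apply: emeasurable_funM.
- by move=> s _; apply: integral_ge0 => y _; rewrite mule_ge0.
- apply: (@measurable_integral_section (fun x y => (normc (H y) ^+ 2)%:E * (poisson e (x - y))%:E)%E); last first.
    by move=> x y; rewrite mule_ge0.
  by apply: emeasurable_funM => //; exact: (emeasurable_snd mn2).
rewrite (@integral_convolution _ (fun s => (poisson e s)%:E))//; last first.
  by move=> y; rewrite lee_fin poisson_ge0.
rewrite integral_poisson// ge0_integralZr//; last by rewrite lee_fin pi_ge0.
set I := integral _ _ _; have I0 : (0 <= I)%E by apply: integral_ge0.
rewrite -ge0_muleDr// ?lee_fin ?pi_ge0// -EFinD muleC.
by rewrite (_ : pi + pi = 2 * pi)//; ring.
Qed.

(** Monotone convergence in [bessel_abel] as the Abel factor increases to 1. *)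
Lemma bessel (H : R -> R[i]) : cintegrable mu H ->
  (\int[mu]_u (normc (fourier H u) ^+ 2)%:E <=
   (2 * pi)%:E * \int[mu]_s (normc (H s) ^+ 2)%:E)%E.
Proof.
move=> iH.
have mF := cmeasurable_fourier (cintegrable_measurable iH).
pose g n u : \bar R := (abel n.+1%:R^-1 u * normc (fourier H u) ^+ 2)%:E.
have gl u : limn (g^~ u) = (normc (fourier H u) ^+ 2)%:E.
  apply/cvg_lim => //; apply: cvg_EFin; first exact: nearW.
  rewrite -[X in _ --> X]mul1r; apply: cvgM; last exact: cvg_cst.
  rewrite /abel -[X in _ --> X]expR0; apply: continuous_cvg; first exact: continuous_expR.
  rewrite -[X in _ --> X]oppr0; apply: cvgN; rewrite -[X in _ --> X](mul0r `|u|).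
  by apply: cvgM; [exact: cvg_harmonic|exact: cvg_cst].
have cg : (\int[mu]_u g n u @[n --> \oo] --> \int[mu]_u (normc (fourier H u) ^+ 2)%:E)%E.
  under [X in _ --> X]eq_integral do rewrite -gl.
  apply: cvg_monotone_convergence => //.
  - move=> n; apply/measurable_EFinP; apply: measurable_funM; first exact: measurable_abel.
    by apply: measurable_funX; exact: cmeasurable_normc.
  - by move=> n u _; rewrite lee_fin mulr_ge0 ?expR_ge0 ?sqr_ge0.
  - move=> u _ n m nm; rewrite lee_fin ler_wpM2r ?sqr_ge0// /abel ler_expR lerN2.
    by rewrite ler_wpM2r// lef_pV2 ?posrE// ler_nat.
rewrite -(cvg_lim _ cg)//; apply: lime_le.
  by apply/cvg_ex; eexists; exact: cg.
by apply: nearW => n; exact: bessel_abel.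
Qed.

End bessel.

(** * The Fourier transform of a derivative *)

Section fourier_derivative.
Context (R : realType).
Local Notation mu := (@lebesgue_measure R).

Lemma poisson1_le_harmonic (n : nat) : poisson 1 (n%:R : R) <= harmonic n.
Proof.
rewrite /poisson /harmonic expr1n div1r lef_pV2 ?posrE ?ltr0Sn// ?ltr_pwDl ?sqr_ge0//.
by rewrite -natrX -natr1 addrC lerD2l ler_nat -mulnn; case: n => // n; exact: leq_pmulr.
Qed.

Lemma poissonN (e t : R) : poisson e (- t) = poisson e t.
Proof. by rewrite /poisson sqrrN. Qed.

(** The primitive [W] vanishes at infinity, so the integrals of [w] over
    [[-n, n]] tend to 0; they also tend to the integral of [w]. *)
Lemma integral_derive_eq0 (W w : R -> R) (M : R) :
  (forall x : R, is_derive x 1 W (w x)) -> continuous w ->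
  mu.-integrable setT (EFin \o w) ->
  (forall x, `|W x| <= M * poisson 1 x) -> \int[mu]_x w x = 0.
Proof.
move=> dW cw iw WM.
have M0 : 0 <= M.
  have := le_trans (normr_ge0 _) (WM 0).
  by rewrite /poisson expr1n expr0n addr0 invr1 mul1r mulr1.
pose I n := `[- (n%:R : R), n%:R]%classic.
have cvI : (\int[mu]_(x in I n) w x)%R @[n --> \oo] --> \int[mu]_x w x.
  under eq_cvg do rewrite Rintegral_mkcond.
  have [||||| i1 _ i3] := @dominated_convergence _ _ _ mu setT measurableT
    (fun n x => ((w \_ (I n)) x)%:E) (EFin \o w) (fun x => `|w x|%:E).
  - move=> n; apply/measurable_EFinP; apply/(measurable_restrictT _ _).1 => //.
      exact: measurable_itv.
    by apply: measurable_funTS; exact: continuous_measurable_fun.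
  - by apply/measurable_EFinP; exact: continuous_measurable_fun.
  - apply/aeW => x _; apply: cvg_near_cst.
    near=> n; rewrite patchE ifT// inE /I /= in_itv /= -ler_norml.
    by near: n; exact: nbhs_infty_ger.
  - exact: integrable_abse iw.
  - apply/aeW => x n _; rewrite lee_fin patchE; case: ifPn => // _.
    by rewrite normr0.
  - by apply: fine_cvg; rewrite fineK//; exact: integrable_fin_num.
have cv0 : (\int[mu]_(x in I n) w x)%R @[n --> \oo] --> 0.
  have H n : `|\int[mu]_(x in I n) w x| <= 2 * M * harmonic n.
    case: n => [|n].
      rewrite /I oppr0 set_itv1 Rintegral_set1 normr0.
      by rewrite !mulr_ge0// harmonic_ge0.
    rewrite /Rintegral (@continuous_FTC2 _ _ W).
    - apply: le_trans (ler_normB _ _) _; rewrite -mulrA mulr_natl mulr2n.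
      have HM : M * poisson 1 (n.+1%:R : R) <= M * harmonic n.+1.
        by rewrite ler_wpM2l// poisson1_le_harmonic.
      apply: lerD; first exact: le_trans (WM _) HM.
      by apply: le_trans (WM _) _; rewrite poissonN.
    - by rewrite gtrN.
    - exact: continuous_subspaceT.
    - have cW : continuous W.
        move=> x; apply: differentiable_continuous; apply/derivable1_diffP.
        exact: ex_derive.
      split; first by move=> x _; exact: ex_derive.
        by apply: cvg_at_right_filter; exact: cW.
      by apply: cvg_at_left_filter; exact: cW.
    - by move=> x _; rewrite derive1E derive_val.
  have ch : 2 * M * harmonic n @[n --> \oo] --> (0 : R).
    rewrite -[X in _ --> X](mulr0 (2 * M)); apply: cvgM; first exact: cvg_cst.
    exact: cvg_harmonic.
  apply: (@squeeze_cvgr _ _ _ _ (fun n => - (2 * M * harmonic n)) (fun n => 2 * M * harmonic n)) => //.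
    by apply: nearW => n; rewrite -ler_norml.
  by rewrite -oppr0; exact: cvgN.
exact: (cvg_unique (@Rhausdorff R) cvI cv0).
Unshelve. all: by end_near. Qed.

Lemma cintegrable_le_poisson (f : R -> R[i]) (M : R) :
  cmeasurable (f : measurableTypeR R -> R[i]) ->
  (forall x, normc (f x) <= M * poisson 1 x) -> cintegrable mu f.
Proof.
move=> mf fM.
have ip := integrable_scale M (integrable_poisson (@ltr01 R)).
apply: (le_cintegrable mf ip) => x /=; rewrite lee_fin.
exact: le_trans (fM x) (ler_norm _).
Qed.

(** Integration by parts, in the form that the derivative of
    [u(x) exp(-ix xi)] has integral 0. *)
Lemma fourier_derive (u v : R -> R[i]) (M xi : R) :
  (forall x : R, is_derive x 1 (fun x : R => complex.Re (u x)) (complex.Re (v x))) ->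
  (forall x : R, is_derive x 1 (fun x : R => complex.Im (u x)) (complex.Im (v x))) ->
  continuous (fun x => complex.Re (v x)) -> continuous (fun x => complex.Im (v x)) ->
  (forall x, normc (u x) <= M * poisson 1 x) ->
  (forall x, normc (v x) <= M * poisson 1 x) ->
  fourier v xi = (0 +i* xi) * fourier u xi.
Proof.
move=> dr di cr ci uM vM.
have cur : continuous (fun x => complex.Re (u x)).
  move=> x; apply: differentiable_continuous; apply/derivable1_diffP.
  by have := dr x => ?; exact: ex_derive.
have cui : continuous (fun x => complex.Im (u x)).
  move=> x; apply: differentiable_continuous; apply/derivable1_diffP.
  by have := di x => ?; exact: ex_derive.
have meas_u : cmeasurable (u : measurableTypeR R -> R[i]).
  by split; exact: continuous_measurable_fun.
have mv : cmeasurable (v : measurableTypeR R -> R[i]).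
  by split; exact: continuous_measurable_fun.
have iu := cintegrable_le_poisson meas_u uM.
have iv := cintegrable_le_poisson mv vM.
have iue := cintegrable_fourier_integrand xi iu.
have ive := cintegrable_fourier_integrand xi iv.
(* w is the derivative of u x * expi (- (x * xi)). *)
pose w x := v x * expi (- (x * xi)) + (0 -i* xi) * (u x * expi (- (x * xi))).
have iw : cintegrable mu w by apply: cintegrableD => //; exact: cintegrableZ.
suff w0 : cintegral mu w = 0.
  have : cintegral mu w = fourier v xi + (0 -i* xi) * fourier u xi.
    by rewrite /w cintegralD//; [rewrite cintegralZl|exact: cintegrableZ].
  rewrite w0 => /esym/eqP; rewrite addr_eq0 => /eqP ->; rewrite -mulNr; congr (_ * _).
  by apply: complex_eqP; rewrite /= ?oppr0 ?opprK.
have cc : continuous (fun x : R => cos (- (x * xi))).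
  move=> x; apply: (@continuous_comp _ _ _ (fun x : R => - (x * xi)) cos); last exact: continuous_cos.
  by apply: cvgN; exact: mulrr_continuous.
have cs : continuous (fun x : R => sin (- (x * xi))).
  move=> x; apply: (@continuous_comp _ _ _ (fun x : R => - (x * xi)) sin); last exact: continuous_sin.
  by apply: cvgN; exact: mulrr_continuous.
have [iwr iwi] := iw.
have wr x : complex.Re (w x) = complex.Re (v x) * cos (- (x * xi)) - complex.Im (v x) * sin (- (x * xi)) +
    xi * (complex.Re (u x) * sin (- (x * xi)) + complex.Im (u x) * cos (- (x * xi))).
  by rewrite /w ReD !ReM !ImM /=; ring.
have wi x : complex.Im (w x) = complex.Re (v x) * sin (- (x * xi)) + complex.Im (v x) * cos (- (x * xi)) -
    xi * (complex.Re (u x) * cos (- (x * xi)) - complex.Im (u x) * sin (- (x * xi))).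
  by rewrite /w ImD !ImM !ReM /=; ring.
have nW x : normc (u x * expi (- (x * xi))) <= M * poisson 1 x.
  by rewrite normcM normc_expi mulr1.
apply: complex_eqP; rewrite /cintegral /=.
- apply: (@integral_derive_eq0 (fun x => complex.Re (u x) * cos (- (x * xi)) - complex.Im (u x) * sin (- (x * xi))) _ M) => //.
  + move=> x; have := dr x; have := di x => ? ?.
    by apply: is_derive_eq; rewrite wr /GRing.scale /=; ring.
  + rewrite (funext wr).
    move=> x; apply: cvgD; first by apply: cvgB; apply: cvgM; [exact: cr|exact: cc|exact: ci|exact: cs].
    by apply: cvgM; [exact: cvg_cst|apply: cvgD; apply: cvgM; [exact: cur|exact: cs|exact: cui|exact: cc]].
  + by move=> x; apply: le_trans (nW x); apply: le_trans (Re_le_normc _); rewrite ReM.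
- apply: (@integral_derive_eq0 (fun x => complex.Re (u x) * sin (- (x * xi)) + complex.Im (u x) * cos (- (x * xi))) _ M) => //.
  + move=> x; have := dr x; have := di x => ? ?.
    by apply: is_derive_eq; rewrite wi /GRing.scale /=; ring.
  + rewrite (funext wi).
    move=> x; apply: cvgB; first by apply: cvgD; apply: cvgM; [exact: cr|exact: cs|exact: ci|exact: cc].
    by apply: cvgM; [exact: cvg_cst|apply: cvgB; apply: cvgM; [exact: cur|exact: cc|exact: cui|exact: cs]].
  + by move=> x; apply: le_trans (nW x); apply: le_trans (Im_le_normc _); rewrite ImM.
Qed.

End fourier_derivative.

(** * The bilinear operator in physical space *)

Section bilinear_representation.
Context (R : realType).
Local Notation mu := (@lebesgue_measure R).
Implicit Types f g chi : R -> R[i].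

Lemma cintegrable_bounded_normc f (h : R -> R[i]) : cintegrable mu f ->
  cmeasurable (h : measurableTypeR R -> R[i]) -> (exists M, forall x, normc (h x) <= M) ->
  cintegrable mu (fun x => f x * h x).
Proof. by move=> fi mh [M hM]; exact: (cintegrableMbounded fi mh hM). Qed.

Lemma fourier_shift g x xi : cintegrable mu g ->
  fourier (fun t => g (t + x)) xi = fourier g xi * expi (x * xi).
Proof.
move=> gi; have gie := cintegrable_fourier_integrand xi gi.
rewrite {2}/fourier (cintegral_affine x (oner_neq0 R) gie) normr1 mul1r.
rewrite -cintegralZr; last exact: cintegrable_affine (oner_neq0 _) gie.
apply: eq_cintegral => t; rewrite mul1r -mulrA -expiD; congr (_ * expi _); ring.
Qed.

Lemma fourier_modulation g xi u : fourier g (u + xi) = fourier (fun t => g t * expi (- (t * xi))) u.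
Proof.
apply: eq_cintegral => t; rewrite -mulrA -expiD; congr (_ * expi _); ring.
Qed.

(** For fixed [xi] the substitution [eta = xi + u] and the exchange formula turn
    the integral in [eta] into [exp(ix xi) * fourier G xi], where
    [G t = g (t + x) * fourier chi t].  A second use of the exchange formula
    moves the transform from [G] back to [fourier f], where inversion
    produces [2 pi f (x - t)]. *)
Lemma bilinear_opE f g chi M x :
  cintegrable mu f -> cintegrable mu (fourier f) ->
  continuous (fun y => complex.Re (f y)) -> continuous (fun y => complex.Im (f y)) ->
  (forall y, normc (f y) <= M) ->
  cintegrable mu g -> cintegrable mu (fourier g) ->
  cintegrable mu chi -> (exists B, forall y, normc (chi y) <= B) ->
  bilinear_op chi f g x =
  (2 * pi)%:C * cintegral mu (fun t => f (x - t) * g (t + x) * fourier chi t).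
Proof.
move=> fi ffi cr ci fM gi fgi chii [B chiB].
have mchi := cintegrable_measurable chii.
pose K (z : measurableTypeR R * measurableTypeR R) :=
  expi (x * (z.1 + z.2)) * chi (z.2 - z.1).
have mK : cmeasurable K.
  apply: cmeasurableM.
    by apply: cmeasurable_expi; apply: measurable_funM => //; exact: measurable_funD.
  have [mr mi] := mchi; split.
  - by apply: (measurableT_comp mr); exact: measurable_funB.
  - by apply: (measurableT_comp mi); exact: measurable_funB.
have KB z : normc (K z) <= B by rewrite /K normcM normc_expi mul1r.
rewrite /bilinear_op.
have -> : (fun z : measurableTypeR R * measurableTypeR R =>
    expi (x * (z.1 + z.2)) * fourier f z.1 * fourier g z.2 * chi (z.2 - z.1)) =
    (fun z => fourier f z.1 * fourier g z.2 * K z).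
  by apply/funext => z; rewrite /K; ring.
rewrite (kernel_fubini12 ffi fgi mK KB).
pose h t := g (t + x).
have hi : cintegrable mu h.
  have := cintegrable_affine x (oner_neq0 R) gi.
  by under eq_fun do rewrite mul1r.
have [C FC] := fourier_bounded chii.
have mFchi := cmeasurable_fourier mchi.
pose G t := h t * fourier chi t.
have Gi : cintegrable mu G by apply: cintegrable_bounded_normc => //; exists C.
have inner xi : cintegral mu (fun eta => fourier g eta * K (xi, eta)) =
    expi (x * xi) * fourier G xi.
  have iK : cintegrable mu (fun eta => fourier g eta * K (xi, eta)).
    apply: cintegrable_bounded_normc => //; first exact: cmeasurable_pair2.
    by exists B => eta; exact: KB.
  rewrite (cintegral_affine xi (oner_neq0 R) iK) normr1 mul1r.
  have ihx : cintegrable mu (fun t => h t * expi (- (t * xi))).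
    exact: cintegrable_fourier_integrand.
  transitivity (cintegral mu (fun u => expi (x * xi) *
      (chi u * fourier (fun t => h t * expi (- (t * xi))) u))).
    apply: eq_cintegral => u; rewrite -fourier_modulation fourier_shift// /K /= mul1r.
    have -> : u + xi - xi = u by ring.
    have -> : x * (xi + (u + xi)) = x * xi + x * (u + xi) by ring.
    by rewrite expiD; ring.
  rewrite cintegralZl; last first.
    apply: cintegrable_bounded_normc => //; last exact: fourier_bounded.
    by apply: cmeasurable_fourier; exact: cintegrable_measurable ihx.
  congr (_ * _); rewrite fourier_multiplication//.
  by apply: eq_cintegral => t; rewrite /G; ring.
under eq_cintegral do rewrite inner mulrA.
have fei : cintegrable mu (fun xi => fourier f xi * expi (x * xi)).
  by apply: cintegrable_mul_expi => //; exact: measurable_funM.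
have iF : cintegrable mu (fun t => f (x - t) * g (t + x) * fourier chi t).
  have -> : (fun t => f (x - t) * g (t + x) * fourier chi t) = (fun t => G t * f (x - t)).
    by apply/funext => t; rewrite /G [RHS]mulrC mulrA.
  apply: cintegrable_bounded_normc => //.
    have [mr mi] := cintegrable_measurable fi; split.
    - by apply: (measurableT_comp mr); exact: measurable_funB.
    - by apply: (measurableT_comp mi); exact: measurable_funB.
  by exists M.
apply: etrans (fourier_multiplication Gi fei) _.
transitivity (cintegral mu (fun t => (2 * pi)%:C * (f (x - t) * g (t + x) * fourier chi t)));
  last exact: cintegralZl.
apply: eq_cintegral => t.
have -> : fourier (fun xi => fourier f xi * expi (x * xi)) t = (2 * pi)%:C * f (x - t).
  rewrite -(fourier_inversion (x - t) fi ffi cr ci fM).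
  apply: eq_cintegral => xi; rewrite -mulrA -expiD; congr (_ * expi _); ring.
rewrite /G /h; ring.
Qed.

End bilinear_representation.

(** * Schwartz functions and compactly supported symbols *)

Section schwartz_functions.
Context (R : realType).
Local Notation mu := (@lebesgue_measure R).
Implicit Types f chi : R -> R[i].

Lemma cderive1n0 f : cderive1n 0 f = f.
Proof. by apply/funext => x; rewrite /cderive1n !derive1n0; case: (f x). Qed.

Lemma csmooth_is_derive_Re f n (x : R) : csmooth f ->
  is_derive x 1 (fun t : R => complex.Re (cderive1n n f t)) (complex.Re (cderive1n n.+1 f x)).
Proof.
move=> /(_ n x)[dr _]; apply: DeriveDef => //=.
by rewrite derive1E.
Qed.

Lemma csmooth_is_derive_Im f n (x : R) : csmooth f ->
  is_derive x 1 (fun t : R => complex.Im (cderive1n n f t)) (complex.Im (cderive1n n.+1 f x)).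
Proof.
move=> /(_ n x)[_ di]; apply: DeriveDef => //=.
by rewrite derive1E.
Qed.

Lemma csmooth_continuous_Re f n : csmooth f ->
  continuous (fun t : R => complex.Re (cderive1n n f t)).
Proof.
move=> sf x; apply: differentiable_continuous; apply/derivable1_diffP.
by have := csmooth_is_derive_Re n x sf => ?; exact: ex_derive.
Qed.

Lemma csmooth_continuous_Im f n : csmooth f ->
  continuous (fun t : R => complex.Im (cderive1n n f t)).
Proof.
move=> sf x; apply: differentiable_continuous; apply/derivable1_diffP.
by have := csmooth_is_derive_Im n x sf => ?; exact: ex_derive.
Qed.

Lemma csmooth_cmeasurable f n : csmooth f ->
  cmeasurable (cderive1n n f : measurableTypeR R -> R[i]).
Proof.
by move=> sf; split; apply: continuous_measurable_fun;
  [exact: csmooth_continuous_Re|exact: csmooth_continuous_Im].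
Qed.

Lemma poisson1_le1 (x : R) : poisson 1 x <= 1.
Proof. by rewrite -[leRHS]invr1 poisson_le. Qed.

(** Combines the two seminorm bounds that express decay like [1 / (1 + x^2)],
    an integrable majorant. *)
Lemma le_poisson1 (a A B x : R) : a <= A -> `|x| ^+ 2 * a <= B ->
  a <= (A + B) * poisson 1 x.
Proof.
move=> aA aB; have p := sqrD_gt0 x (@ltr01 R).
rewrite /poisson mul1r ler_pdivlMr// expr1n mulrDr mulr1.
by rewrite lerD// mulrC -real_normK ?num_real.
Qed.

Lemma schwartz_decay f n : schwartz f ->
  exists M, forall x, normc (cderive1n n f x) <= M * poisson 1 x.
Proof.
move=> [_ sf]; have [A hA] := sf 0 n; have [B hB] := sf 2 n.
exists (A + B) => x; apply: le_poisson1; last exact: hB.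
by have := hA x; rewrite expr0 mul1r.
Qed.

Lemma schwartz_cintegrable f n : schwartz f -> cintegrable mu (cderive1n n f).
Proof.
move=> sf; have [M fM] := schwartz_decay n sf.
by apply: cintegrable_le_poisson fM; apply: csmooth_cmeasurable; case: sf.
Qed.

Lemma schwartz_bounded f : schwartz f -> exists M, forall x, normc (f x) <= M.
Proof.
move=> sf; have [M fM] := schwartz_decay 0 sf; exists M => x.
rewrite -{1}(cderive1n0 f); apply: le_trans (fM x) _; rewrite ler_piMr ?poisson1_le1//.
have := le_trans (normc_ge0 _) (fM 0).
by rewrite /poisson expr1n expr0n addr0 invr1 !mulr1.
Qed.

Lemma schwartz_fourier_derive f n xi : schwartz f ->
  fourier (cderive1n n.+1 f) xi = (0 +i* xi) * fourier (cderive1n n f) xi.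
Proof.
move=> sf; have [A fA] := schwartz_decay n sf; have [B fB] := schwartz_decay n.+1 sf.
have [smf _] := sf.
apply: (@fourier_derive _ _ _ (Num.max A B)).
- by move=> x; exact: csmooth_is_derive_Re.
- by move=> x; exact: csmooth_is_derive_Im.
- exact: csmooth_continuous_Re.
- exact: csmooth_continuous_Im.
- by move=> x; apply: le_trans (fA x) _; rewrite ler_wpM2r ?poisson_ge0// le_max lexx.
- by move=> x; apply: le_trans (fB x) _; rewrite ler_wpM2r ?poisson_ge0// le_max lexx orbT.
Qed.

Lemma schwartz_fourier_derive2 f xi : schwartz f ->
  fourier (cderive1n 2 f) xi = (- xi ^+ 2)%:C * fourier f xi.
Proof.
move=> sf; rewrite !schwartz_fourier_derive// cderive1n0 mulrA; congr (_ * _).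
by apply: complex_eqP; rewrite ?ReM ?ImM /=; ring.
Qed.

(** Both [fourier f] and [xi^2 * fourier f] are bounded, the latter being, up to
    sign, the transform of the second derivative. *)
Lemma schwartz_fourier_cintegrable f : schwartz f -> cintegrable mu (fourier f).
Proof.
move=> sf; have [A hA] := fourier_bounded (schwartz_cintegrable 0 sf).
have [B hB] := fourier_bounded (schwartz_cintegrable 2 sf).
apply: (@cintegrable_le_poisson _ _ (A + B)).
  by apply: cmeasurable_fourier; rewrite -(cderive1n0 f); apply: csmooth_cmeasurable; case: sf.
move=> xi; apply: le_poisson1.
  by have := hA xi; rewrite cderive1n0.
have := hB xi; rewrite schwartz_fourier_derive2// normcM normcR normrN normrX.
by [].
Qed.

Lemma derive1n_near0 (h : R -> R) (U : set R) n : open U ->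
  (forall y, U y -> h y = 0) -> forall y, U y -> derive1n n h y = 0.
Proof.
move=> oU hU; elim: n => [|n ih] y Uy; first exact: hU.
rewrite derive1nS derive1E (@near_eq_derive _ _ _ _ (cst 0)).
  by rewrite derive_cst.
by near=> z; apply: ih; near: z; exact: open_nbhs_nbhs.
Unshelve. all: by end_near. Qed.

Lemma cderive1n_out chi (w : set R) n x : csupport chi `<=` w -> ~ w x ->
  cderive1n n chi x = 0.
Proof.
move=> cw nwx.
have nx : (~` csupport chi) x by move=> /cw.
have oU : open (~` csupport chi) by apply: closed_openC; exact: closed_closure.
have chi0 y : (~` csupport chi) y -> chi y = 0.
  move=> ny; apply/eqP; apply: contrapT => /negP cy; apply: ny.
  exact: subset_closure.
apply: complex_eqP => /=.
- by apply: (derive1n_near0 n oU) => // y /chi0 ->.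
- by apply: (derive1n_near0 n oU) => // y /chi0 ->.
Qed.

Lemma bounded_interval_sub (w : set R) x : bounded_interval w -> w x ->
  inf w <= x <= sup w.
Proof.
move=> [_ [_ hi] [_ hs] _] wx; apply/andP; split.
  exact: ge_inf.
exact: ub_le_sup.
Qed.

(** All derivatives vanish outside [w], and on the closed interval spanned by
    [w] they are bounded by compactness. *)
Lemma compact_support_schwartz chi (w : set R) : bounded_interval w ->
  csmooth chi -> csupport chi `<=` w -> schwartz chi.
Proof.
move=> bw sc cw; split => // m n.
have le_iw : inf w <= sup w by case: bw => _ _ _ /ltW.
pose g x := `|x| ^+ m * (`|complex.Re (cderive1n n chi x)| + `|complex.Im (cderive1n n chi x)|).
have cg : continuous g.
  move=> x; apply: cvgM.
    apply: (@continuous_comp _ _ _ (fun x : R => `|x|) (fun y : R => y ^+ m)).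
      exact: norm_continuous.
    exact: exprn_continuous.
  apply: cvgD.
    apply: (@continuous_comp _ _ _ (fun x : R => complex.Re (cderive1n n chi x)) (fun y : R => `|y|)).
      exact: csmooth_continuous_Re.
    exact: norm_continuous.
  apply: (@continuous_comp _ _ _ (fun x : R => complex.Im (cderive1n n chi x)) (fun y : R => `|y|)).
    exact: csmooth_continuous_Im.
  exact: norm_continuous.
have [c _ hc] := EVT_max le_iw (continuous_subspaceT cg).
exists (Num.max 0 (g c)) => x; have [wx|wx] := pselect (w x); last first.
  by rewrite (cderive1n_out n cw wx) normc0 mulr0 le_max lexx.
rewrite le_max; apply/orP; right.
apply: (@le_trans _ _ (g x)).
  by rewrite ler_wpM2l ?exprn_ge0// normc_le_ReIm.
by apply: hc; rewrite in_itv/=; exact: bounded_interval_sub.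
Qed.

Lemma lebesgue_setT_gt0 : (0 < mu setT)%E.
Proof.
have -> : [set: measurableTypeR R] = (`]-oo, +oo[%classic : set R) by rewrite set_itvNyy.
by rewrite lebesgue_measure_itv/= ltry.
Qed.

Lemma adapted_ae Cst (w : set R) chi i : adapted Cst w chi ->
  {ae mu, forall x, normc (cderive1n i chi x) <= Cst i * ilength w ^- i}.
Proof.
move=> [_ _ /(_ i)]; rewrite /cLnorm unlock.
rewrite lebesgue_setT_gt0; move=> /ess_supP; apply: filterS => x /=.
by rewrite lee_fin ger0_norm ?normc_ge0.
Qed.

End schwartz_functions.

(** * Summing over the intervals *)

Section square_function_bound.
Context (R : realType).
Local Notation mu := (@lebesgue_measure R).
Implicit Types f g chi : R -> R[i].

Lemma measurable_bounded_interval (w : set R) : bounded_interval w ->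
  measurable (w : set (measurableTypeR R)).
Proof. by move=> [iw _ _ _]; exact: is_interval_measurable. Qed.

Lemma ilength_gt0 (w : set R) : bounded_interval w -> 0 < ilength w.
Proof. by move=> [_ _ _]; rewrite subr_gt0. Qed.

Lemma lebesgue_bounded_interval_le (w : set R) : bounded_interval w ->
  (mu w <= (ilength w)%:E)%E.
Proof.
move=> bw; have := bw => -[_ _ _ lt_is].
have -> : (ilength w)%:E = mu `[inf w, sup w]%classic.
  by rewrite lebesgue_measure_itv/= lte_fin lt_is.
apply: le_measure; rewrite ?inE.
- exact: measurable_bounded_interval.
- exact: measurable_itv.
- by move=> x wx; rewrite /= in_itv/=; exact: bounded_interval_sub.
Qed.

Lemma idouble_sub (w : set R) : bounded_interval w -> w `<=` idouble w.
Proof.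
move=> bw x wx; have := bw => -[iw [w0 hi] [_ hs] lt_is].
have cw : w (icenter w).
  have /inf_lt[//|a wa ac] : inf w < icenter w by rewrite /icenter; lra.
  have /sup_gt[//|b wb cb] : icenter w < sup w by rewrite /icenter; lra.
  by apply: (iw a b) => //; rewrite !ltW.
exists (icenter w + (x - icenter w) / 2); last by field.
have [xc|cx] := leP x (icenter w).
  by apply: (iw x (icenter w)) => //; apply/andP; split; lra.
by apply: (iw (icenter w) x) => //; apply/andP; split; lra.
Qed.

(** Cauchy-Schwarz against the constant 1, obtained by integrating
    [(c - h)^2 >= 0] with [c] the mean of [h]; the bound [B] makes [c]
    finite. *)
Lemma sqr_integral_le (w : set R) (h : R -> R) (B : R) : bounded_interval w ->
  measurable_fun setT h -> (forall x, 0 <= h x <= B) ->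
  ((\int[mu]_(x in w) (h x)%:E) ^+ 2 <=
   (ilength w)%:E * \int[mu]_(x in w) (h x ^+ 2)%:E)%E.
Proof.
move=> bw mh hB.
have mw := measurable_bounded_interval bw.
have l0 := ilength_gt0 bw.
have muw := lebesgue_bounded_interval_le bw.
have mhw : measurable_fun w (fun x => (h x)%:E).
  by apply/measurable_EFinP; exact: measurable_funS mh.
have mh2w : measurable_fun w (fun x => (h x ^+ 2)%:E).
  by apply/measurable_EFinP; apply: measurable_funX; exact: measurable_funS mh.
have h0 x : 0 <= h x by case/andP: (hB x).
set I := (\int[mu]_(x in w) (h x)%:E)%E; set J := (\int[mu]_(x in w) _)%E.
have I0 : (0 <= I)%E by apply: integral_ge0 => x _; rewrite lee_fin.
have J0 : (0 <= J)%E by apply: integral_ge0 => x _; rewrite lee_fin sqr_ge0.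
have Ifin : I \is a fin_num.
  rewrite ge0_fin_numE//.
  apply: (@le_lt_trans _ _ (\int[mu]_(x in w) (B%:E))%E).
    apply: ge0_le_integral => //.
    - by move=> x _; rewrite lee_fin.
    - by move=> x _; rewrite lee_fin; case/andP: (hB x).
  rewrite integral_cst//; apply: (@le_lt_trans _ _ (B%:E * (ilength w)%:E)%E).
    by apply: lee_wpmul2l => //; rewrite lee_fin; case/andP: (hB 0) => /le_trans; apply.
  by rewrite -EFinM ltry.
have [Jy|Jfin] := eqVneq J +oo%E.
  by rewrite Jy gt0_muley ?leey// lte_fin.
have {}Jfin : J \is a fin_num by rewrite ge0_fin_numE// ltey.
pose c := fine I / ilength w.
have c0 : 0 <= c by rewrite divr_ge0 ?fine_ge0// ltW.
have key : ((2 * c)%:E * I <= (c ^+ 2 * ilength w)%:E + J)%E.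
  rewrite -ge0_integralZl//; [|by move=> x _; rewrite lee_fin|by rewrite lee_fin mulr_ge0].
  apply: (@le_trans _ _ (\int[mu]_(x in w) ((c ^+ 2)%:E + (h x ^+ 2)%:E))%E).
    apply: ge0_le_integral => //.
    - by move=> x _; rewrite -EFinM lee_fin; apply: mulr_ge0 => //; exact: mulr_ge0.
    - exact: measurable_funeM.
    - by apply: emeasurable_funD.
    - move=> x _; rewrite -EFinM -EFinD lee_fin; have := sqr_ge0 (c - h x); lra.
  rewrite ge0_integralD//; [|by move=> x _; rewrite lee_fin sqr_ge0..].
  rewrite integral_cst// EFinM leeD2r//; apply: lee_wpmul2l => //.
  by rewrite lee_fin sqr_ge0.
move: key; rewrite -(fineK Ifin) -(fineK Jfin) -!EFinM -EFinD !lee_fin /c expr2.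
rewrite [X in _ <= X + _](_ : _ = fine I ^+ 2 / ilength w); last by field; rewrite gt_eqF.
rewrite [X in X <= _](_ : _ = 2 * (fine I ^+ 2 / ilength w)); last by field; rewrite gt_eqF.
move=> key; have : fine I ^+ 2 / ilength w <= fine J by lra.
by rewrite ler_pdivrMr// [X in _ <= X]mulrC.
Qed.

Definition twisted f g x t : R[i] := f (x - t) * g (t + x).

(** The weight [1 / (1 + L^2 t^2)] localizes at scale [1 / L], the scale dual to
    the length of the frequency intervals. *)
Definition damped (L : R) f g x t : R[i] := twisted f g x t * (poisson 1 (L * t))%:C.

Lemma cmeasurable_twisted f g x : cmeasurable (f : measurableTypeR R -> R[i]) ->
  cmeasurable (g : measurableTypeR R -> R[i]) ->
  cmeasurable (twisted f g x : measurableTypeR R -> R[i]).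
Proof.
move=> [fr fi] [gr gi]; apply: cmeasurableM; split.
- by apply: (measurableT_comp fr); exact: measurable_funB.
- by apply: (measurableT_comp fi); exact: measurable_funB.
- by apply: (measurableT_comp gr); exact: measurable_funD.
- by apply: (measurableT_comp gi); exact: measurable_funD.
Qed.

Lemma schwartz_cmeasurable f : schwartz f -> cmeasurable (f : measurableTypeR R -> R[i]).
Proof. by move=> [sf _]; have := csmooth_cmeasurable 0 sf; rewrite cderive1n0. Qed.

Lemma schwartz_cintegrable0 f : schwartz f -> cintegrable mu f.
Proof. by move=> sf; have := schwartz_cintegrable 0 sf; rewrite cderive1n0. Qed.

Lemma measurable_poisson_scale (L : R) : measurable_fun setT (fun t : R => poisson 1 (L * t)).
Proof.
apply: (@measurableT_comp _ _ _ _ _ _ (poisson 1)); first exact: measurable_poisson.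
exact: measurable_funM.
Qed.

Lemma cintegrable_damped L f g x : schwartz f -> schwartz g ->
  cintegrable mu (damped L f g x).
Proof.
move=> sf sg; have [M fM] := schwartz_bounded sf.
have gi : cintegrable mu (fun t => g (t + x)).
  have := cintegrable_affine x (oner_neq0 R) (schwartz_cintegrable0 sg).
  by under eq_fun do rewrite mul1r.
have := cmeasurable_twisted x (schwartz_cmeasurable sf) (schwartz_cmeasurable sg).
move=> mt; have mp := measurable_poisson_scale L.
have -> : damped L f g x = (fun t => g (t + x) * (f (x - t) * (poisson 1 (L * t))%:C)).
  by apply/funext => t; rewrite /damped /twisted [RHS]mulrCA [RHS]mulrA.
apply: cintegrable_bounded_normc => //.
  apply: cmeasurableM; last exact: cmeasurable_real.
  have [fr fi] := schwartz_cmeasurable sf; split.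
  - by apply: (measurableT_comp fr); exact: measurable_funB.
  - by apply: (measurableT_comp fi); exact: measurable_funB.
exists M => t; rewrite normcM ger0_normc ?poisson_ge0//.
have M0 : 0 <= M := le_trans (normc_ge0 _) (fM 0).
by rewrite -[leRHS]mulr1 ler_pM ?normc_ge0 ?poisson_ge0 ?poisson1_le1.
Qed.

(** On the Fourier side [1 - L^2 D^2] is multiplication by [1 + (L t)^2], which
    cancels the weight in [damped]; the exchange formula then moves the
    transform from the symbol to the product of [f] and [g]. *)
Lemma bilinear_op_damped L f g chi x : schwartz f -> schwartz g -> schwartz chi ->
  bilinear_op chi f g x = (2 * pi)%:C *
    cintegral mu (fun u => (chi u + (- L ^+ 2)%:C * cderive1n 2 chi u) *
                           fourier (damped L f g x) u).
Proof.
move=> sf sg sc.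
have [M fM] := schwartz_bounded sf.
have ic := schwartz_cintegrable0 sc; have ic2 := schwartz_cintegrable 2 sc.
have [smf _] := sf.
have cr : continuous (fun y => complex.Re (f y)).
  by have := @csmooth_continuous_Re _ f 0 smf; rewrite cderive1n0.
have ci : continuous (fun y => complex.Im (f y)).
  by have := @csmooth_continuous_Im _ f 0 smf; rewrite cderive1n0.
have E := bilinear_opE x (schwartz_cintegrable0 sf) (schwartz_fourier_cintegrable sf)
  cr ci fM (schwartz_cintegrable0 sg) (schwartz_fourier_cintegrable sg) ic (schwartz_bounded sc).
apply: (etrans E) => {E}; apply: (congr1 (GRing.mul (2 * pi)%:C)).
have ipsi : cintegrable mu (fun u => chi u + (- L ^+ 2)%:C * cderive1n 2 chi u).
  by apply: cintegrableD => //; exact: cintegrableZ.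
apply: etrans (esym (fourier_multiplication (cintegrable_damped L x sf sg) ipsi)).
apply: eq_cintegral => t.
have -> : fourier (fun u => chi u + (- L ^+ 2)%:C * cderive1n 2 chi u) t =
    (1 + (L * t) ^+ 2)%:C * fourier chi t.
  have ic2e := cintegrable_fourier_integrand t ic2.
  have E : fourier (fun u => chi u + (- L ^+ 2)%:C * cderive1n 2 chi u) t =
      fourier chi t + (- L ^+ 2)%:C * fourier (cderive1n 2 chi) t.
    rewrite /fourier -cintegralZl// -cintegralD//; last 2 first.
    - exact: cintegrable_fourier_integrand.
    - exact: cintegrableZ.
    by apply: eq_cintegral => u; rewrite mulrDl mulrA.
  rewrite E schwartz_fourier_derive2// mulrA -rmorphM /=.
  rewrite -[X in X + _]mul1r -mulrDl; congr (_ * _).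
  by apply: complex_eqP => /=; ring.
rewrite /damped /twisted [RHS]mulrA; congr (_ * _).
rewrite -[RHS]mulrA -rmorphM /= [X in _ * X%:C](_ : _ = 1) ?mulr1//.
by rewrite /poisson expr1n mul1r mulVf// gt_eqF// ltr_pwDl// sqr_ge0.
Qed.

(** The symbol [chi - L^2 chi''] vanishes outside [w] and is bounded by
    [Cst 0 + K^2 Cst 2] since [L <= K |w|]; Cauchy-Schwarz on [w] then keeps
    only the frequencies of [damped L f g x] that lie in [w]. *)
Lemma sqr_bilinear_op_le (Cst : nat -> R) (K L : R) (w : set R) f g chi x :
  0 < L -> L <= K * ilength w ->
  bounded_interval w -> adapted Cst w chi -> schwartz f -> schwartz g ->
  ((normc (bilinear_op chi f g x) ^+ 2)%:E <=
   ((2 * pi) ^+ 2 * (Cst 0%N + K ^+ 2 * Cst 2%N) ^+ 2 * ilength w)%:E *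
   \int[mu]_(u in w) (normc (fourier (damped L f g x) u) ^+ 2)%:E)%E.
Proof.
move=> L0 LK bw ad sf sg.
have l0 := ilength_gt0 bw.
have mw := measurable_bounded_interval bw.
have [sm cw _] := ad.
have sc := compact_support_schwartz bw sm cw.
rewrite (bilinear_op_damped L x sf sg sc) normcM ger0_normc ?mulr_ge0 ?pi_ge0//.
set psi := fun u => chi u + (- L ^+ 2)%:C * cderive1n 2 chi u.
set B := Cst 0%N + _; set H := damped L f g x.
have iH := cintegrable_damped L x sf sg.
have [A HA] := fourier_bounded iH.
have mFH := cmeasurable_fourier (cintegrable_measurable iH).
have mnF : measurable_fun setT (fun u => normc (fourier H u)) by exact: cmeasurable_normc.
have mpsi : cmeasurable (psi : measurableTypeR R -> R[i]).
  apply: cmeasurableD; first exact: schwartz_cmeasurable.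
  by apply: cmeasurableM; [exact: cmeasurable_cst|exact: csmooth_cmeasurable].
(* The derivative bounds are essential suprema, hence hold almost everywhere only. *)
have psiB : {ae mu, forall u, setT u -> ((normc (psi u * fourier H u))%:E <=
    B%:E * ((fun u => (normc (fourier H u))%:E) \_ w) u)%E}.
  have a0 := adapted_ae 0 ad; have a2 := adapted_ae 2 ad.
  have FF := ae_filter_ringOfSetsType mu.
  apply: filterS2 a0 a2 => u c0 c2 _; rewrite patchE.
  case: ifPn => [uw|/negP uw]; last first.
    have nwu : ~ w u by move=> /mem_set.
    rewrite /psi -{1}(cderive1n0 chi) !(cderive1n_out _ cw nwu) mulr0 addr0 mul0r normc0 mule0//.
  rewrite -EFinM lee_fin normcM ler_wpM2r ?normc_ge0//.
  rewrite /psi; apply: le_trans (le_normcD _ _) _; rewrite /B; apply: lerD.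
    by move: c0; rewrite cderive1n0 expr0 invr1 mulr1.
  rewrite normcM normcR normrN ger0_norm ?sqr_ge0//.
  have C2 : 0 <= Cst 2.
    have := le_trans (normc_ge0 _) c2; rewrite pmulr_lge0// invr_gt0 exprn_gt0//.
  apply: (@le_trans _ _ (L ^+ 2 * (Cst 2%N * ilength w ^- 2))).
    by rewrite ler_wpM2l ?sqr_ge0.
  rewrite mulrCA mulrC ler_wpM2r// ler_pdivrMr ?exprn_gt0// -exprMn.
  by rewrite ler_pXn2r ?nnegrE ?(ltW L0)// (le_trans (ltW L0) LK).
have mpF : cmeasurable ((fun u => psi u * fourier H u) : measurableTypeR R -> R[i]).
  exact: cmeasurableM.
have mFw : measurable_fun setT (((fun u => (normc (fourier H u))%:E) \_ w) : R -> \bar R).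
  apply/(measurable_restrictT _ _).1 => //.
  by apply: measurable_funTS; exact/measurable_EFinP.
have F0 u : (0 <= ((fun u => (normc (fourier H u))%:E) \_ w) u)%E.
  by apply: erestrict_ge0 => v _; rewrite lee_fin normc_ge0.
set I := (\int[mu]_(u in w) (normc (fourier H u))%:E)%E.
have key : ((normc (cintegral mu (fun u => psi u * fourier H u)))%:E <= `|B|%:E * I)%E.
  apply: le_trans (normc_cintegral_le _ mpF) _.
  have IE : I = (\int[mu]_u ((fun u => (normc (fourier H u))%:E) \_ w) u)%E.
    by rewrite /I integral_mkcond.
  rewrite IE -ge0_integralZl//.
  apply: ae_ge0_le_integral => //.
  - by move=> u _; rewrite lee_fin normc_ge0.
  - by apply/measurable_EFinP; exact: cmeasurable_normc.
  - by move=> u _; rewrite mule_ge0.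
  - exact: measurable_funeM.
  - have FF := ae_filter_ringOfSetsType mu; apply: filterS psiB => u H1 H2; apply: le_trans (H1 H2) _.
    by apply: lee_wpmul2r => //; rewrite lee_fin ler_norm.
have I0 : (0 <= I)%E by apply: integral_ge0 => u _; rewrite lee_fin normc_ge0.
rewrite exprMn -[X in (_ <= X%:E * _)%E]mulrA.
rewrite (EFinM ((2 * pi) ^+ 2)) (EFinM ((2 * pi) ^+ 2)) -muleA; apply: lee_wpmul2l.
  by rewrite lee_fin sqr_ge0.
apply: (@le_trans _ _ ((`|B|%:E * I) ^+ 2)%E).
  by rewrite EFin_expe lee_sqr ?mule_ge0 ?lee_fin ?normc_ge0.
rewrite expe2 muleACA -!expe2 -EFin_expe real_normK ?num_real// (EFinM (B ^+ 2) (ilength w)) -muleA.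
apply: lee_wpmul2l; first by rewrite lee_fin sqr_ge0.
by apply: (sqr_integral_le bw mnF (B := A)) => u; rewrite normc_ge0 HA.
Qed.

(** Each interval is contained in its double, whose overlaps are controlled. *)
Lemma fsum_indic_le (Omega A : set (set R)) (N u : R) : finite_set A ->
  A `<=` Omega -> (forall w, Omega w -> bounded_interval w) ->
  well_distributed N Omega -> (\sum_(w \in A) (\1_w u : R)%:E <= N%:E)%E.
Proof.
move=> finA AO bO /(_ u); apply: le_trans.
apply: (@esum_ge _ _ Omega (fun w => (\1_(idouble w) u : R)%:E)); exists A => //.
apply: lee_fsum => // w Aw; rewrite lee_fin !indicE ler_nat.
have [uw|//] := boolP (u \in w).
rewrite mem_set//; apply: idouble_sub; first exact/bO/AO.
exact: set_mem uw.
Qed.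

(** The intervals cover each frequency at most [N] times, so the local energies
    of [damped L f g x] add up to at most [N] times its total energy, which
    Bessel's inequality bounds. *)
Lemma esum_sqr_bilinear_op_le (Omega : set (set R)) (chi : set R -> R -> R[i])
    (Cst : nat -> R) (N K L : R) f g x :
  0 < L -> 0 <= N -> 0 <= K ->
  (forall w, Omega w -> bounded_interval w) ->
  (forall w, Omega w -> L <= K * ilength w /\ ilength w <= K * L) ->
  well_distributed N Omega ->
  (forall w, Omega w -> adapted Cst w (chi w)) -> schwartz f -> schwartz g ->
  (\esum_(w in Omega) (normc (bilinear_op (chi w) f g x) ^+ 2)%:E <=
   ((2 * pi) ^+ 2 * (Cst 0%N + K ^+ 2 * Cst 2%N) ^+ 2 * K * N * (2 * pi) * L)%:E *
   \int[mu]_t (normc (damped L f g x t) ^+ 2)%:E)%E.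
Proof.
move=> L0 N0 K0 bO lO dO aO sf sg.
apply: ge_ereal_sup => _ [A [finA AO] <-].
set c := (2 * pi) ^+ 2 * _; set H := damped L f g x.
have c0 : 0 <= c by rewrite mulr_ge0 ?sqr_ge0.
have iH := cintegrable_damped L x sf sg.
have mFH := cmeasurable_fourier (cintegrable_measurable iH).
pose q u := normc (fourier H u) ^+ 2.
have mq : measurable_fun setT q by apply: measurable_funX; exact: cmeasurable_normc.
have q0 u : 0 <= q u by rewrite sqr_ge0.
pose F (w : set R) u : \bar R := if w \in A then ((\1_w u : R)%:E * (q u)%:E)%E else 0%E.
have mF w : measurable_fun setT (F w).
  have [Aw|/negbTE nA] := boolP (w \in A); last by rewrite /F nA.
  rewrite /F Aw; move/set_mem : Aw => Aw; apply: emeasurable_funM; apply/measurable_EFinP => //.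
  by apply: measurable_indic; exact: measurable_bounded_interval (bO _ (AO _ Aw)).
have F0 w u : (0 <= F w u)%E.
  by rewrite /F; case: ifPn => // _; rewrite -EFinM lee_fin mulr_ge0.
apply: (@le_trans _ _ (\sum_(w \in A) ((c * (K * L))%:E * \int[mu]_u F w u))%E).
  apply: lee_fsum => // w Aw.
  have Ow := AO _ Aw; have [l1 l2] := lO _ Ow.
  have mw := measurable_bounded_interval (bO _ Ow).
  apply: le_trans (sqr_bilinear_op_le x L0 l1 (bO _ Ow) (aO _ Ow) sf sg) _.
  have -> : (\int[mu]_u F w u = \int[mu]_(u in w) (q u)%:E)%E.
    rewrite [RHS]integral_mkcond; apply: eq_integral => u _.
    rewrite /F mem_set// patchE indicE; case: ifPn => _; first by rewrite mul1e.
    by rewrite mul0e.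
  apply: lee_wpmul2r; first by apply: integral_ge0 => u _; rewrite lee_fin sqr_ge0.
  by rewrite lee_fin ler_wpM2l.
rewrite -ge0_mule_fsumr; last by move=> w; exact: integral_ge0.
rewrite -ge0_integral_fsum//.
have -> : c * K * N * (2 * pi) * L = c * (K * L) * (N * (2 * pi)) by ring.
rewrite [in leRHS]EFinM -muleA; apply: lee_wpmul2l.
  by rewrite lee_fin; apply: mulr_ge0 => //; apply: mulr_ge0 => //; exact: ltW.
apply: (@le_trans _ _ (\int[mu]_u (N%:E * (q u)%:E))%E).
  apply: ge0_le_integral => //.
  - by move=> u _; apply: fsume_ge0 => w _.
  - by apply: emeasurable_fsum.
  - by apply: measurable_funeM; exact/measurable_EFinP.
  - move=> u _; have := fsum_indic_le u finA AO bO dO.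
    have q0' : (0 <= (q u)%:E)%E by rewrite lee_fin.
    move=> /(lee_wpmul2r q0'); apply: le_trans; rewrite ge0_mule_fsuml; last by move=> w; rewrite lee_fin.
    by apply: lee_fsum => // w Aw; rewrite /F mem_set.
have mq' : measurable_fun setT (fun u => (q u)%:E) by exact/measurable_EFinP.
have -> : (\int[mu]_u (N%:E * (q u)%:E) = N%:E * \int[mu]_u (q u)%:E)%E.
  by apply: ge0_integralZl => // u _; rewrite lee_fin.
rewrite (EFinM N) -muleA; apply: lee_wpmul2l; first by rewrite lee_fin.
exact: bessel.
Qed.

End square_function_bound.

(** * Inequalities of Hoelder and Jensen for extended nonnegative functions *)

Section power_means.
Context d (T : measurableType d) (R : realType).
Variable mu : {measure set T -> \bar R}.
Local Open Scope ereal_scope.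

(** Weighted arithmetic-geometric inequality for [x / a] and [y / b], stated so
    that integrating it with [a] and [b] the integrals of [x] and [y] yields
    Hoelder's inequality. *)
Lemma young_ereal (t a b : R) (x y : \bar R) : (0 < t < 1)%R -> (0 < a)%R -> (0 < b)%R ->
  0 <= x -> 0 <= y ->
  x `^ t * y `^ (1 - t) <=
  (a `^ t * b `^ (1 - t))%:E * ((t / a)%:E * x + ((1 - t) / b)%:E * y).
Proof.
move=> /andP[t0 t1] a0 b0; have t1' : (0 < 1 - t)%R by rewrite subr_gt0.
have ab : 0 < (a `^ t * b `^ (1 - t))%:E by rewrite lte_fin mulr_gt0 ?powR_gt0.
have ta : 0 < (t / a)%:E by rewrite lte_fin divr_gt0.
have tb : 0 < ((1 - t) / b)%:E by rewrite lte_fin divr_gt0.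
case: x => [x| |//] x0; last first.
  move=> y0; rewrite [X in _ <= _ * (X + _)]gt0_muley// addye ?gt0_muley ?leey//.
  by rewrite gt_eqF// (lt_le_trans (ltNyr 0))// mule_ge0// ltW.
case: y => [y| |//] y0; last first.
  by rewrite [X in _ <= _ * (_ + X)]gt0_muley// addey// gt0_muley ?leey.
rewrite !poweR_EFin -(EFinM (t / a)) -(EFinM ((1 - t) / b)) -EFinD -!EFinM lee_fin.
rewrite !lee_fin in x0 y0.
have key (X Y : R) : (0 <= X)%R -> (0 <= Y)%R ->
    ((a * X) `^ t * (b * Y) `^ (1 - t) <= a `^ t * b `^ (1 - t) * (t * X + (1 - t) * Y))%R.
  move=> X0 Y0; have := @conjugate_powR _ (X `^ t)%R (Y `^ (1 - t))%R t^-1%R (1 - t)^-1%R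
    (powR_ge0 _ _) (powR_ge0 _ _).
  rewrite !invr_gt0 !invrK => /(_ t0 t1').
  rewrite subrKC => /(_ erefl).
  rewrite -!powRrM !divff ?gt_eqF// !powRr1// [(X * t)%R]mulrC [(Y * (1 - t))%R]mulrC => H.
  rewrite !powRM ?(ltW a0) ?(ltW b0)// mulrACA.
  by apply: ler_wpM2l; first by rewrite mulr_ge0 ?powR_ge0.
have xE : x = (a * (x / a))%R by field; rewrite gt_eqF.
have yE : y = (b * (y / b))%R by field; rewrite gt_eqF.
have := key (x / a)%R (y / b)%R; rewrite -xE -yE => /(_ (divr_ge0 x0 (ltW a0)) (divr_ge0 y0 (ltW b0))).
by rewrite !mulrA (mulrAC t) (mulrAC (1 - t)%R).
Qed.

Lemma measurable_poweR_fun (U : T -> \bar R) (t : R) : measurable_fun setT U ->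
  measurable_fun setT (fun x => U x `^ t).
Proof. by move=> mU; apply: (measurableT_comp (measurable_poweR t) mU). Qed.

Lemma ge0_integral0_poweR (U V : T -> \bar R) (t : R) : t != 0%R ->
  measurable_fun setT U -> measurable_fun setT V -> (forall x, 0 <= U x) ->
  \int[mu]_x U x = 0 -> \int[mu]_x (U x `^ t * V x) = 0.
Proof.
move=> t0 mU mV U0 iU.
have aeU : ae_eq mu setT U (cst 0).
  apply/(ae_eq_integral_abs mu measurableT mU); rewrite -[RHS]iU.
  by apply: eq_integral => x _; rewrite gee0_abs.
rewrite (ae_eq_integral (cst 0)) ?integral0//.
- apply: emeasurable_funM => //; exact: measurable_poweR_fun.
- have FF := ae_filter_ringOfSetsType mu.
  by apply: filterS aeU => x /(_ I) + _ => /= ->; rewrite poweR0r// mul0e.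
Qed.

(** When both integrals are positive and finite, integrate [young_ereal]; a
    vanishing integral forces the left-hand side to vanish, and an infinite
    one makes the bound trivial. *)
Lemma hoelder_powers (U V : T -> \bar R) (t : R) : (0 < t < 1)%R ->
  measurable_fun setT U -> measurable_fun setT V ->
  (forall x, 0 <= U x) -> (forall x, 0 <= V x) ->
  \int[mu]_x (U x `^ t * V x `^ (1 - t)) <=
  (\int[mu]_x U x) `^ t * (\int[mu]_x V x) `^ (1 - t).
Proof.
move=> t01 mU mV U0 V0; have /andP[t0 t1] := t01.
have t1' : (0 < 1 - t)%R by rewrite subr_gt0.
have mUt := measurable_poweR_fun t mU.
have mVt := measurable_poweR_fun (1 - t) mV.
have [iU0|iUN0] := eqVneq (\int[mu]_x U x) 0.
  rewrite iU0 ge0_integral0_poweR ?gt_eqF// poweR0r ?gt_eqF// mul0e//.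
have [iV0|iVN0] := eqVneq (\int[mu]_x V x) 0.
  under eq_integral do rewrite muleC.
  by rewrite iV0 ge0_integral0_poweR ?gt_eqF// poweR0r ?gt_eqF// mule0.
have iU0 : 0 < \int[mu]_x U x by rewrite lt0e iUN0 integral_ge0.
have iV0 : 0 < \int[mu]_x V x by rewrite lt0e iVN0 integral_ge0.
have [iUy|iUy] := eqVneq (\int[mu]_x U x) +oo.
  by rewrite iUy poweRyr ?gt_eqF// gt0_mulye ?leey// poweR_gt0.
have [iVy|iVy] := eqVneq (\int[mu]_x V x) +oo.
  by rewrite iVy poweRyr ?gt_eqF// gt0_muley ?leey// poweR_gt0.
have fU : \int[mu]_x U x \is a fin_num by rewrite ge0_fin_numE ?ltey// ltW.
have fV : \int[mu]_x V x \is a fin_num by rewrite ge0_fin_numE ?ltey// ltW.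
pose a := fine (\int[mu]_x U x); pose b := fine (\int[mu]_x V x).
have aE : \int[mu]_x U x = a%:E by rewrite fineK.
have bE : \int[mu]_x V x = b%:E by rewrite fineK.
have a0 : (0 < a)%R by rewrite -lte_fin -aE.
have b0 : (0 < b)%R by rewrite -lte_fin -bE.
have ta : 0 <= (t / a)%:E by rewrite lee_fin divr_ge0 ?ltW.
have tb : 0 <= ((1 - t) / b)%:E by rewrite lee_fin divr_ge0 ?ltW.
pose W x := (t / a)%:E * U x + ((1 - t) / b)%:E * V x.
have mW : measurable_fun setT W by apply: emeasurable_funD; exact: measurable_funeM.
have W0 x : 0 <= W x by rewrite adde_ge0// mule_ge0.
apply: (@le_trans _ _ (\int[mu]_x ((a `^ t * b `^ (1 - t))%:E * W x))).
  apply: ge0_le_integral => //.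
  - by move=> x _; rewrite mule_ge0 ?poweR_ge0.
  - exact: emeasurable_funM.
  - exact: measurable_funeM.
  - by move=> x _; exact: young_ereal.
rewrite ge0_integralZl ?lee_fin ?mulr_ge0 ?powR_ge0//.
rewrite ge0_integralD//; last 4 first.
- by move=> x _; rewrite mule_ge0.
- exact: measurable_funeM.
- by move=> x _; rewrite mule_ge0.
- exact: measurable_funeM.
rewrite !ge0_integralZl// aE bE !poweR_EFin -(EFinM (t / a)) -(EFinM ((1 - t) / b)).
rewrite -EFinD -!EFinM lee_fin.
rewrite [X in (_ * X <= _)%R](_ : _ = 1%R) ?mulr1//.
by field; rewrite !gt_eqF.
Qed.

(** Hoelder's inequality for [A * w] and [w], as [(A w)^q w^(1-q) = A^q w]. *)
Lemma jensen_poweR (A : T -> \bar R) (w : T -> R) (q : R) : (0 < q <= 1)%R ->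
  measurable_fun setT A -> measurable_fun setT w ->
  (forall x, 0 <= A x) -> (forall x, 0 <= w x)%R -> \int[mu]_x (w x)%:E = 1 ->
  \int[mu]_x (A x `^ q * (w x)%:E) <= (\int[mu]_x (A x * (w x)%:E)) `^ q.
Proof.
move=> /andP[q0]; rewrite le_eqVlt => /orP[/eqP ->|q1] mA mw A0 w0 iw.
  rewrite poweRe1; last by apply: integral_ge0 => x _; rewrite mule_ge0 ?lee_fin.
  by under eq_integral do rewrite poweRe1//.
have q1' : (0 < 1 - q)%R by rewrite subr_gt0.
have mw' : measurable_fun setT (fun x => (w x)%:E) by exact/measurable_EFinP.
have q01 : (0 < q < 1)%R by rewrite q0.
have := @hoelder_powers (fun x => A x * (w x)%:E) (fun x => (w x)%:E) q q01.
rewrite iw poweR1r mule1 => H; apply: le_trans (H _ _ _ _); last 4 first.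
- exact: emeasurable_funM.
- by [].
- by move=> x; rewrite mule_ge0 ?lee_fin.
- by move=> x; rewrite lee_fin.
under [leRHS]eq_integral => x _.
  rewrite poweRM ?lee_fin// -muleA !poweR_EFin -EFinM.
  rewrite -powRD ?subrKC ?powRr1//; last by rewrite oner_eq0.
  over.
by [].
Qed.

End power_means.

(** * Averages against probability densities *)

Section averaging.
Context (R : realType).
Local Notation mu := (@lebesgue_measure R).
Local Open Scope ereal_scope.

Definition convolution (h : R -> \bar R) (k : R -> R) (y : R) : \bar R :=
  \int[mu]_s (h s * (k (y - s)%R)%:E).

Lemma convolution_ge0 (h : R -> \bar R) (k : R -> R) y : (forall x, 0 <= h x) -> (forall x, (0 <= k x)%R) ->
  0 <= convolution h k y.
Proof. by move=> h0 k0; apply: integral_ge0 => s _; rewrite mule_ge0 ?lee_fin. Qed.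

Lemma measurable_kernel_sub (k : R -> R) (y : R) : measurable_fun setT k ->
  measurable_fun setT (fun s : R => k (y - s)%R).
Proof. by move=> mk; apply: (measurableT_comp mk); exact: measurable_funB. Qed.

Lemma measurable_convolution (h : R -> \bar R) (k : R -> R) : measurable_fun setT h -> measurable_fun setT k ->
  (forall x, 0 <= h x) -> (forall x, (0 <= k x)%R) ->
  measurable_fun setT (convolution h k).
Proof.
move=> mh mk h0 k0.
apply: (@measurable_integral_section _ (fun y s => h s * (k (y - s)%R)%:E)).
  apply: emeasurable_funM; first exact: emeasurable_snd.
  by apply/measurable_EFinP; exact: (measurableT_comp mk (@measurable_subRR R)).
by move=> x y; rewrite mule_ge0 ?lee_fin.
Qed.

Lemma integral_kernel_sub (k : R -> R) (y : R) : measurable_fun setT k ->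
  (forall x, (0 <= k x)%R) ->
  \int[mu]_s (k (y - s)%R)%:E = \int[mu]_s (k s)%:E.
Proof.
move=> mk k0.
rewrite [RHS](@ge0_integral_affine _ (-1) y)//.
- rewrite normrN normr1 mul1e; apply: eq_integral => s _.
  by congr (k _)%:E; ring.
- exact/measurable_EFinP.
Qed.

Section prob_kernel.
Variable k : R -> R.
Hypotheses (mk : measurable_fun setT k) (k0 : forall x, (0 <= k x)%R).
Hypothesis k1 : \int[mu]_s (k s)%:E = 1.

Lemma integral_prob_convolution (h : R -> \bar R) : measurable_fun setT h -> (forall x, 0 <= h x) ->
  \int[mu]_y convolution h k y = \int[mu]_s h s.
Proof.
move=> mh h0; rewrite (@integral_convolution _ h (fun s => (k s)%:E))//.
- by rewrite k1 mule1.
- exact/measurable_EFinP.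
Qed.

Lemma convolution_poweR_le (h : R -> \bar R) (q : R) y : (0 < q <= 1)%R -> measurable_fun setT h ->
  (forall x, 0 <= h x) ->
  convolution (fun s => h s `^ q) k y <= convolution h k y `^ q.
Proof.
move=> q01 mh h0; apply: jensen_poweR => //.
- exact: measurable_kernel_sub.
- by rewrite integral_kernel_sub.
Qed.

(** Averaging can only increase the integral of a concave power: apply Jensen's
    inequality at each point, then use that convolution with a probability
    density preserves integrals. *)
Lemma integral_poweR_le_convolution (h : R -> \bar R) (q : R) : (0 < q <= 1)%R ->
  measurable_fun setT h -> (forall x, 0 <= h x) ->
  \int[mu]_s h s `^ q <= \int[mu]_y convolution h k y `^ q.
Proof.
move=> q01 mh h0; have mhq := measurable_poweR_fun q mh.
rewrite -integral_prob_convolution//; last by move=> x; exact: poweR_ge0.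
apply: ge0_le_integral => //.
- by move=> y _; apply: convolution_ge0 => // x; exact: poweR_ge0.
- by apply: measurable_convolution => // x; exact: poweR_ge0.
- by apply: measurable_poweR_fun; exact: measurable_convolution.
- by move=> y _; exact: convolution_poweR_le.
Qed.

End prob_kernel.

(** The map [(x, t) -> (x - t, x + t)] has Jacobian 2. *)
Lemma integral_midpoint (a b : R -> \bar R) :
  measurable_fun setT a -> measurable_fun setT b ->
  (forall x, 0 <= a x) -> (forall x, 0 <= b x) ->
  \int[mu]_x \int[mu]_t (a (x - t)%R * b (t + x)%R) =
  (2^-1)%:E * ((\int[mu]_x a x) * (\int[mu]_x b x)).
Proof.
move=> ma mb a0 b0.
have N1 : (-1 : R)%R != 0%R by rewrite oppr_eq0 oner_eq0.
have inner x : \int[mu]_t (a (x - t)%R * b (t + x)%R) =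
    \int[mu]_s (a s * b (2 * x - s)%R).
  rewrite (@ge0_integral_affine _ (-1) x (fun t => a (x - t)%R * b (t + x)%R))//.
  - rewrite normrN normr1 mul1e; apply: eq_integral => s _.
    by congr (a _ * b _); ring.
  - apply: emeasurable_funM.
      by apply: (measurableT_comp ma); exact: measurable_funB.
    by apply: (measurableT_comp mb); exact: measurable_funD.
  - by move=> t; rewrite mule_ge0.
under eq_integral do rewrite inner.
rewrite (@fubini_tonelli _ _ _ _ _ mu mu (fun z => a z.2 * b (2 * z.1 - z.2)%R))//=; last 2 first.
- apply: emeasurable_funM; first exact: emeasurable_snd.
  by apply: (measurableT_comp mb); apply: measurable_funB => //; exact: measurable_funM.
- by move=> z; rewrite mule_ge0.
have bs s : \int[mu]_x b (2 * x - s)%R = (2^-1)%:E * \int[mu]_x b x.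
  rewrite (@ge0_integral_affine _ 2 (- s) b)// muleA -EFinM normr_nat mulVf// mul1e//.
have mbs s : measurable_fun setT (fun x : R => b (2 * x - s)%R).
  by apply: (measurableT_comp mb); apply: measurable_funB => //; exact: measurable_funM.
under eq_integral => s _.
  rewrite ge0_integralZl//; last exact: (mbs s).
  rewrite bs; over.
rewrite ge0_integralZr//; last by rewrite mule_ge0 ?lee_fin ?invr_ge0// integral_ge0.
by rewrite muleCA.
Qed.

End averaging.

(** * Averaging the pointwise bound *)

Section normalized_kernels.
Context (R : realType).
Local Notation mu := (@lebesgue_measure R).

(** The integral of a nonnegative function is a supremum over the simple
    functions below it, and those below [f] are below [g]. *)
Lemma ge0_integral_mono d (T : measurableType d) (m : {measure set T -> \bar R})
    (f g : T -> \bar R) : (forall x, 0 <= f x)%E -> (forall x, f x <= g x)%E ->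
  (\int[m]_x f x <= \int[m]_x g x)%E.
Proof.
move=> f0 fg; have g0 x : (0 <= g x)%E := le_trans (f0 x) (fg x).
rewrite !ge0_integralTE//; apply: ge_ereal_sup => _ [h hf <-]; apply: ereal_sup_ubound; exists h => // x.
exact: le_trans (hf x) (fg x).
Qed.

(** The densities [box L] and [cauchy L] both live at scale [1 / L]: the first
    has compact support, so that it can be used to average; the second has the
    tail of the weight in [damped]. *)
Definition box (L s : R) : R := L / 2 * \1_(`[- L^-1, L^-1]%classic : set R) s.

Definition cauchy (L s : R) : R := L / pi * poisson 1 (L * s).

Section scale.
Variable L : R.
Hypothesis L0 : 0 < L.

Lemma box_ge0 s : 0 <= box L s.
Proof. by rewrite /box mulr_ge0// divr_ge0// ltW. Qed.

Lemma measurable_box : measurable_fun setT (box L).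
Proof.
apply: measurable_funM => //; apply: measurable_indic; exact: measurable_itv.
Qed.

Lemma integral_box : (\int[mu]_s (box L s)%:E = 1)%E.
Proof.
have mI : measurable (`[- L^-1, L^-1]%classic : set (measurableTypeR R)).
  exact: measurable_itv.
under eq_integral do rewrite /box EFinM.
rewrite ge0_integralZl//; last 2 first.
- by apply/measurable_EFinP; exact: measurable_indic.
- by rewrite lee_fin divr_ge0// ltW.
have -> : (\int[mu]_s (\1_(`[- L^-1, L^-1]%classic : set R) s)%:E =
          mu `[(- L^-1)%R, (L^-1)%R]%classic)%E.
  by rewrite integral_indic// setIT.
rewrite lebesgue_measure_itv/= lte_fin.
rewrite gtrN ?invr_gt0// -EFinB -EFinM; congr (_%:E); by field; rewrite gt_eqF.
Qed.

Lemma cauchy_ge0 s : 0 <= cauchy L s.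
Proof. by rewrite /cauchy mulr_ge0 ?poisson_ge0// divr_ge0 ?pi_ge0// ltW. Qed.

Lemma measurable_cauchy : measurable_fun setT (cauchy L).
Proof. by apply: measurable_funM => //; exact: measurable_poisson_scale. Qed.

Lemma integral_cauchy : (\int[mu]_s (cauchy L s)%:E = 1)%E.
Proof.
under eq_integral do rewrite /cauchy EFinM.
rewrite ge0_integralZl//; last 3 first.
- by apply/measurable_EFinP; exact: measurable_poisson_scale.
- by move=> s _; rewrite lee_fin poisson_ge0.
- by rewrite lee_fin divr_ge0 ?pi_ge0// ltW.
have := integral_poisson (@ltr01 R).
rewrite (@ge0_integral_affine _ L 0 (fun t => (poisson 1 t)%:E)) ?gt_eqF//; last 2 first.
- by apply/measurable_EFinP; exact: measurable_poisson.
- by move=> t; rewrite lee_fin poisson_ge0.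
have -> : (\int[mu]_t (poisson 1 (L * t + 0))%:E = \int[mu]_t (poisson 1 (L * t))%:E)%E.
  by apply: eq_integral => t _; rewrite addr0.
rewrite gtr0_norm// => H.
by rewrite (EFinM L pi^-1) muleAC H -EFinM mulfV// gt_eqF// pi_gt0.
Qed.

(** Harnack's inequality at scale [1 / L]: with [a = L t] and [|b| <= 1] one has
    [1 + (a + b)^2 <= 3 + 2 a^2 <= 3 (1 + a^2)]. *)
Lemma poisson_harnack s t : `|s| <= L^-1 -> poisson 1 (L * t) <= 3 * poisson 1 (L * (t + s)).
Proof.
move=> sL; have Ls : (L * s) ^+ 2 <= 1.
  rewrite -real_normK ?num_real// normrM gtr0_norm// exprn_ile1 ?mulr_ge0 ?(ltW L0)//.
  by rewrite -(@ler_pM2l _ L) // mulfV ?gt_eqF// in sL.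
rewrite /poisson !expr1n !mul1r -[leRHS]invrK invf_div.
rewrite lef_pV2 ?posrE ?divr_gt0 ?ltr_pwDl ?sqr_ge0// ler_pdivrMr//.
have := sqr_ge0 (L * t - L * s); have := sqr_ge0 (L * t); move: Ls.
set a := L * t; set b := L * s; rewrite (_ : L * (t + s) = a + b) ?mulrDr//; nra.
Qed.

Definition midpoint_mean (u v : R -> R) (x : R) : \bar R :=
  (\int[mu]_t (u (x - t) * v (t + x) * poisson 1 (L * t) ^+ 2)%:E)%E.

Variables u v : R -> R.
Hypotheses (meas_u : measurable_fun setT u) (mv : measurable_fun setT v).
Hypotheses (u0 : forall x, 0 <= u x) (v0 : forall x, 0 <= v x).

Lemma midpoint_mean_ge0 x : (0 <= midpoint_mean u v x)%E.
Proof.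
by apply: integral_ge0 => t _; rewrite lee_fin mulr_ge0 ?sqr_ge0// mulr_ge0.
Qed.

Lemma measurable_midpoint_integrand (x : R) :
  measurable_fun setT (fun t : R => u (x - t) * v (t + x) * poisson 1 (L * t) ^+ 2).
Proof.
apply: measurable_funM; last by apply: measurable_funX; exact: measurable_poisson_scale.
apply: measurable_funM.
- by apply: (measurableT_comp meas_u); exact: measurable_funB.
- by apply: (measurableT_comp mv); exact: measurable_funD.
Qed.

Lemma measurable_midpoint_mean : measurable_fun setT (midpoint_mean u v).
Proof.
apply: (@measurable_integral_section _
  (fun x t => (u (x - t) * v (t + x) * poisson 1 (L * t) ^+ 2)%:E)); last first.
  by move=> x t; rewrite lee_fin mulr_ge0 ?sqr_ge0// mulr_ge0.
apply/measurable_EFinP; apply: measurable_funM.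
  apply: measurable_funM.
  - by apply: (measurableT_comp meas_u); exact: measurable_funB.
  - by apply: (measurableT_comp mv); exact: measurable_funD.
apply: measurable_funX.
exact: (measurableT_comp (measurable_poisson_scale L) measurable_snd).
Qed.

(** If [|x - y| <= 1 / L], then up to a factor 3 the weight at [t] is at most the
    one at [y - (x - t)] and also at most the one at [y - (x + t)], so the
    square of the weight splits into one factor for each of the two points.
    These become independent variables under [integral_midpoint]. *)
Lemma box_midpoint_mean_le y :
  (convolution (midpoint_mean u v) (box L) y <=
   (9 * pi ^+ 2 / (4 * L))%:E * (convolution (EFin \o u) (cauchy L) y *
                                 convolution (EFin \o v) (cauchy L) y))%E.
Proof.
pose a s := ((u s)%:E * (cauchy L (y - s))%:E)%E.
pose b s := ((v s)%:E * (cauchy L (y - s))%:E)%E.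
pose c := 9 * pi ^+ 2 / (2 * L).
have c0 : 0 <= c by rewrite divr_ge0 ?mulr_ge0 ?sqr_ge0 ?pi_ge0 ?(ltW L0).
have mcy := measurable_kernel_sub y measurable_cauchy.
have a0 s : (0 <= a s)%E by rewrite mule_ge0 ?lee_fin ?cauchy_ge0.
have b0 s : (0 <= b s)%E by rewrite mule_ge0 ?lee_fin ?cauchy_ge0.
have ma : measurable_fun setT a by apply: emeasurable_funM; apply/measurable_EFinP.
have mb : measurable_fun setT b by apply: emeasurable_funM; apply/measurable_EFinP.
apply: (@le_trans _ _ (\int[mu]_x (c%:E * \int[mu]_t (a (x - t)%R * b (t + x)%R)))%E).
  apply: ge0_integral_mono => x.
    by rewrite mule_ge0 ?midpoint_mean_ge0 ?lee_fin ?box_ge0.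
  have mabx : measurable_fun setT (fun t : R => a (x - t)%R * b (t + x)%R)%E.
    apply: emeasurable_funM.
    - by apply: (measurableT_comp ma); exact: measurable_funB.
    - by apply: (measurableT_comp mb); exact: measurable_funD.
  rewrite /midpoint_mean -ge0_integralZr//; last 3 first.
  - by apply/measurable_EFinP; exact: measurable_midpoint_integrand.
  - by move=> t _; rewrite lee_fin mulr_ge0 ?sqr_ge0// mulr_ge0.
  - by rewrite lee_fin box_ge0.
  rewrite -ge0_integralZl//; last by move=> t _; rewrite mule_ge0.
  apply: ge0_integral_mono => t.
    by rewrite -EFinM lee_fin mulr_ge0 ?box_ge0// mulr_ge0 ?sqr_ge0// mulr_ge0.
  rewrite /a /b -!EFinM lee_fin /box indicE.
  have [|_] := boolP (y - x \in _); last first.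
    rewrite !mulr0; apply: mulr_ge0 => //; apply: mulr_ge0; apply: mulr_ge0 => //; exact: cauchy_ge0.
  rewrite inE /= in_itv /= -ler_norml => yx; rewrite mulr1.
  have h1 : poisson 1 (L * t) <= 3 * poisson 1 (L * (y - (x - t))).
    by rewrite (_ : y - (x - t) = t + (y - x)); [exact: poisson_harnack|ring].
  have h2 : poisson 1 (L * t) <= 3 * poisson 1 (L * (y - (t + x))).
    rewrite (_ : L * t = - (L * - t)); last by ring.
    by rewrite poissonN (_ : y - (t + x) = - t + (y - x)); [exact: poisson_harnack|ring].
  have hh : poisson 1 (L * t) ^+ 2 <=
      9 * (poisson 1 (L * (y - (x - t))) * poisson 1 (L * (y - (t + x)))).
    have -> : 9 * (poisson 1 (L * (y - (x - t))) * poisson 1 (L * (y - (t + x)))) =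
      (3 * poisson 1 (L * (y - (x - t)))) * (3 * poisson 1 (L * (y - (t + x)))) by ring.
    by rewrite expr2; apply: ler_pM => //; exact: poisson_ge0.
  apply: (@le_trans _ _ (u (x - t) * v (t + x) *
     (9 * (poisson 1 (L * (y - (x - t))) * poisson 1 (L * (y - (t + x))))) * (L / 2))).
    apply: ler_wpM2r; first by rewrite divr_ge0// ltW.
    by apply: ler_wpM2l => //; exact: mulr_ge0.
  rewrite /c /cauchy le_eqVlt; apply/orP; left; apply/eqP.
  set P := poisson _ _; set Q := poisson _ _.
  have := pi_gt0 R; move: (pi : R) => p p0.
  by field; apply/andP; split; rewrite gt_eqF.
rewrite ge0_integralZl//; last 2 first.
- apply: (@measurable_integral_section _ (fun x t => a (x - t)%R * b (t + x)%R)%E).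
    apply: emeasurable_funM.
    - by apply: (measurableT_comp ma); exact: measurable_funB.
    - by apply: (measurableT_comp mb); exact: measurable_funD.
  by move=> x t; rewrite mule_ge0.
- by move=> x _; apply: integral_ge0 => t _; rewrite mule_ge0.
rewrite integral_midpoint// muleA -EFinM /convolution.
rewrite (_ : c / 2 = 9 * pi ^+ 2 / (4 * L))//.
by rewrite /c; field; rewrite gt_eqF.
Qed.

(** Since [q] may be less than 1, Minkowski's inequality is not available for the
    mean in [t]; the extra average over [x] at scale [1 / L] takes its place. *)
Lemma integral_midpoint_mean_poweR_le (q : R) : 0 < q <= 1 ->
  (\int[mu]_x midpoint_mean u v x `^ q <=
   (9 * pi ^+ 2 / (4 * L))%:E `^ q *
   \int[mu]_y (convolution (EFin \o u) (cauchy L) y *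
               convolution (EFin \o v) (cauchy L) y) `^ q)%E.
Proof.
move=> q01.
have c0 : 0 <= 9 * pi ^+ 2 / (4 * L) by rewrite divr_ge0 ?mulr_ge0 ?sqr_ge0 ?pi_ge0 ?(ltW L0).
have mU : measurable_fun setT (convolution (EFin \o u) (cauchy L)).
  apply: measurable_convolution => //; [exact/measurable_EFinP|exact: measurable_cauchy|exact: cauchy_ge0].
have mV : measurable_fun setT (convolution (EFin \o v) (cauchy L)).
  apply: measurable_convolution => //; [exact/measurable_EFinP|exact: measurable_cauchy|exact: cauchy_ge0].
have U0 y : (0 <= convolution (EFin \o u) (cauchy L) y)%E.
  by apply: convolution_ge0 => //; exact: cauchy_ge0.
have V0 y : (0 <= convolution (EFin \o v) (cauchy L) y)%E.
  by apply: convolution_ge0 => //; exact: cauchy_ge0.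
apply: le_trans (integral_poweR_le_convolution measurable_box box_ge0 integral_box q01
  measurable_midpoint_mean midpoint_mean_ge0) _.
rewrite -ge0_integralZl//; last 3 first.
- by apply: measurable_poweR_fun; exact: emeasurable_funM.
- by move=> y _; exact: poweR_ge0.
- exact: poweR_ge0.
apply: ge0_integral_mono => y; first exact: poweR_ge0.
rewrite -poweRM ?mule_ge0// gt0_ler_poweR ?box_midpoint_mean_le//.
- by case/andP: q01 => /ltW.
- by rewrite in_itv/= leey andbT; apply: convolution_ge0; [exact: midpoint_mean_ge0|exact: box_ge0].
- by rewrite in_itv/= leey andbT !mule_ge0.
Qed.

End scale.
End normalized_kernels.

(** * Hoelder's inequality for products of averages *)

Section convolution_hoelder.
Context (R : realType).
Local Notation mu := (@lebesgue_measure R).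
Variable k : R -> R.
Hypotheses (mk : measurable_fun setT k) (k0 : forall x, 0 <= k x).
Hypothesis k1 : (\int[mu]_s (k s)%:E = 1)%E.

Local Notation sqr phi := (fun s : R => (phi s ^+ 2)%:E).
Local Notation N p phi := (Lnorm mu p (EFin \o phi)).

Lemma poweR_le (x y : \bar R) (q : R) : 0 <= q -> (0 <= x)%E -> (x <= y)%E -> (x `^ q <= y `^ q)%E.
Proof.
move=> q0 x0 xy; apply: gt0_ler_poweR => //; rewrite in_itv/= leey andbT//.
exact: le_trans xy.
Qed.

Lemma measurable_sqr (phi : R -> R) : measurable_fun setT phi ->
  measurable_fun setT (sqr phi).
Proof. by move=> mphi; apply/measurable_EFinP; exact: measurable_funX. Qed.

Lemma convolution_sqr_ge0 (phi : R -> R) y : (0 <= convolution (sqr phi) k y)%E.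
Proof. by apply: convolution_ge0 => // x; rewrite lee_fin sqr_ge0. Qed.

(** Jensen's inequality for the concave power [2 / p]. *)
Lemma convolution_sqr_le_powR (p : R) (phi : R -> R) y : 2 <= p ->
  measurable_fun setT phi -> (forall x, 0 <= phi x) ->
  (convolution (sqr phi) k y <=
   convolution (fun s => (phi s `^ p)%:E) k y `^ (2 / p))%E.
Proof.
move=> p2 mphi phi0; have p0 : 0 < p by rewrite (lt_le_trans _ p2).
have sqrE s : (phi s ^+ 2)%:E = ((phi s `^ p)%:E `^ (2 / p))%E.
  by rewrite poweR_EFin -powRrM mulrCA mulfV ?gt_eqF// mulr1 powR_mulrn.
rewrite [X in (X <= _)%E](_ : _ = convolution (fun s => (phi s `^ p)%:E `^ (2 / p))%E k y); last first.
  by apply: eq_integral => s _; rewrite sqrE.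
apply: convolution_poweR_le => //.
- by rewrite divr_gt0//= ler_pdivrMr// mul1r.
- by apply/measurable_EFinP; exact: (measurableT_comp (measurable_powR p)).
- by move=> s; rewrite lee_fin powR_ge0.
Qed.

Lemma convolution_sqr_le_ess_sup (phi : R -> R) y :
  measurable_fun setT phi -> (forall x, 0 <= phi x) ->
  (convolution (sqr phi) k y <= N +oo phi `^ 2)%E.
Proof.
move=> mphi phi0; set M := N +oo phi.
have M0 : (0 <= M)%E by exact: Lnorm_ge0.
have phiM : \forall s \ae mu, ((phi s)%:E <= M)%E.
  have FF := ae_filter_ringOfSetsType mu.
  have : \forall s \ae mu, ((abse \o (EFin \o phi)) s <= M)%E.
    apply/ess_supP; rewrite /M unlock /= lebesgue_setT_gt0; exact: lexx.
  by apply: filterS => s /=; rewrite ger0_norm.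
have K1 : (\int[mu]_s (k (y - s))%:E = 1)%E by rewrite integral_kernel_sub.
rewrite -[leRHS]mule1 -K1 -ge0_integralZl//; last 3 first.
- by apply/measurable_EFinP; exact: measurable_kernel_sub.
- by move=> s _; rewrite lee_fin.
- exact: poweR_ge0.
apply: ae_ge0_le_integral => //.
- by move=> s _; rewrite mule_ge0 ?lee_fin ?sqr_ge0.
- apply: emeasurable_funM; first exact: measurable_sqr.
  by apply/measurable_EFinP; exact: measurable_kernel_sub.
- by move=> s _; rewrite mule_ge0 ?lee_fin ?poweR_ge0.
- apply: emeasurable_funM; first exact: measurable_cst.
  by apply/measurable_EFinP; exact: measurable_kernel_sub.
have FF := ae_filter_ringOfSetsType mu.
apply: filterS phiM => s phisM _; apply: lee_wpmul2r; first by rewrite lee_fin.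
have -> : (phi s ^+ 2)%:E = ((phi s)%:E `^ 2)%E by rewrite poweR_EFin powR_mulrn.
by apply: poweR_le; rewrite ?lee_fin.
Qed.

(** Powers of norms in this form turn the exponents of [hoelder_powers] into
    [r / p1] and [r / p2]. *)
Lemma Lnorm_poweR (p r : R) (phi : R -> R) : (forall x, 0 <= phi x) ->
  (N p%:E phi `^ r = (\int[mu]_s (phi s `^ p)%:E) `^ (r / p))%E.
Proof.
move=> phi0; rewrite unlock /= -poweRrM mulrC; congr (_ `^ _)%E.
by apply: eq_integral => s _; rewrite /= ger0_norm// poweR_EFin.
Qed.

Lemma integral_convolution_sqr_le_sup (r : R) (phi psi : R -> R) : 2 <= r ->
  measurable_fun setT phi -> measurable_fun setT psi ->
  (forall x, 0 <= phi x) -> (forall x, 0 <= psi x) ->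
  (\int[mu]_y (convolution (sqr phi) k y * convolution (sqr psi) k y) `^ (r / 2) <=
   (N +oo phi * N r%:E psi) `^ r)%E.
Proof.
move=> r2 mphi mpsi phi0 psi0; have r0 : 0 < r by rewrite (lt_le_trans _ r2).
have mpr : measurable_fun setT (fun s => (psi s `^ r)%:E).
  by apply/measurable_EFinP; exact: (measurableT_comp (measurable_powR r)).
have pr0 s : (0 <= (psi s `^ r)%:E)%E by rewrite lee_fin powR_ge0.
rewrite poweRM ?Lnorm_ge0// Lnorm_poweR// divff ?gt_eqF// poweRe1; last exact: integral_ge0.
rewrite -(integral_prob_convolution mk k0 k1 mpr pr0).
rewrite -ge0_integralZl//; last 3 first.
- exact: measurable_convolution.
- by move=> y _; exact: convolution_ge0.
- exact: poweR_ge0.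
apply: ge0_integral_mono => y; first exact: poweR_ge0.
rewrite poweRM ?convolution_sqr_ge0//; apply: lee_pmul; rewrite ?poweR_ge0//.
- rewrite [leRHS](_ : _ = (N +oo phi `^ 2) `^ (r / 2))%E; last first.
    by rewrite -poweRrM mulrCA mulfV// mulr1.
  apply: poweR_le; rewrite ?convolution_sqr_ge0 ?convolution_sqr_le_ess_sup//.
  by rewrite divr_ge0// ltW.
- rewrite [leRHS](_ : _ = (convolution (fun s => (psi s `^ r)%:E) k y `^ (2 / r)) `^ (r / 2))%E; last first.
    rewrite -poweRrM (_ : 2 / r * (r / 2) = 1) ?poweRe1//; first exact: convolution_ge0.
    by field; rewrite gt_eqF.
  apply: poweR_le; rewrite ?convolution_sqr_ge0 ?convolution_sqr_le_powR//.
  by rewrite divr_ge0// ltW.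
Qed.

(** Bound each average by the one of the power [p1] or [p2], apply Hoelder's
    inequality with [r / p1 + r / p2 = 1], and use that averaging preserves
    integrals. *)
Lemma integral_convolution_sqr_le_fin (p1 p2 r : R) (phi psi : R -> R) :
  2 <= p1 -> 2 <= p2 -> r^-1 = p1^-1 + p2^-1 ->
  measurable_fun setT phi -> measurable_fun setT psi ->
  (forall x, 0 <= phi x) -> (forall x, 0 <= psi x) ->
  (\int[mu]_y (convolution (sqr phi) k y * convolution (sqr psi) k y) `^ (r / 2) <=
   (N p1%:E phi * N p2%:E psi) `^ r)%E.
Proof.
move=> h1 h2 hr mphi mpsi phi0 psi0.
have p10 : 0 < p1 by rewrite (lt_le_trans _ h1).
have p20 : 0 < p2 by rewrite (lt_le_trans _ h2).
have r0 : 0 < r by rewrite -invr_gt0 hr addr_gt0 ?invr_gt0.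
have r12 : 1 - r / p1 = r / p2.
  by rewrite -[X in X - _](divff (lt0r_neq0 r0)) hr; ring.
have mU (p : R) (h : R -> R) : measurable_fun setT h ->
    measurable_fun setT (fun s => (h s `^ p)%:E).
  by move=> mh; apply/measurable_EFinP; exact: (measurableT_comp (measurable_powR p)).
have U0 (p : R) (h : R -> R) s : (0 <= (h s `^ p)%:E)%E by rewrite lee_fin powR_ge0.
rewrite poweRM ?Lnorm_ge0// !Lnorm_poweR// -r12.
rewrite -(integral_prob_convolution mk k0 k1 (mU p1 phi mphi) (U0 p1 phi)).
rewrite -(integral_prob_convolution mk k0 k1 (mU p2 psi mpsi) (U0 p2 psi)).
apply: le_trans (hoelder_powers mu _ _ _ _ _); last 5 first.
- by rewrite divr_gt0//= -subr_gt0 r12 divr_gt0.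
- by apply: measurable_convolution => //; exact: mU.
- by apply: measurable_convolution => //; exact: mU.
- by move=> y; exact: convolution_ge0.
- by move=> y; exact: convolution_ge0.
apply: ge0_integral_mono => y; first exact: poweR_ge0.
have step (p : R) (h : R -> R) : 2 <= p -> measurable_fun setT h -> (forall x, 0 <= h x) ->
    (convolution (sqr h) k y `^ (r / 2) <=
     convolution (fun s => (h s `^ p)%:E) k y `^ (r / p))%E.
  move=> p2' mh h0; have p0 : 0 < p by rewrite (lt_le_trans _ p2').
  rewrite [r / p](_ : _ = 2 / p * (r / 2)); last by field; rewrite gt_eqF.
  rewrite [leRHS]poweRrM.
  apply: poweR_le; rewrite ?convolution_sqr_ge0 ?convolution_sqr_le_powR//.
  by rewrite divr_ge0// ltW.
by rewrite poweRM ?convolution_sqr_ge0// r12; apply: lee_pmul; rewrite ?poweR_ge0 ?step.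
Qed.

(** If one exponent is infinite the other is [r], and the bounded factor is
    pulled out of the integral; both cannot be infinite as [r] is finite. *)
Lemma integral_convolution_sqr_le (p1 p2 : \bar R) (r : R) (phi psi : R -> R) :
  (2%:E <= p1)%E -> (2%:E <= p2)%E -> 0 < r -> (r^-1)%:E = (p1^-1 + p2^-1)%E ->
  measurable_fun setT phi -> measurable_fun setT psi ->
  (forall x, 0 <= phi x) -> (forall x, 0 <= psi x) ->
  (\int[mu]_y (convolution (sqr phi) k y * convolution (sqr psi) k y) `^ (r / 2) <=
   (N p1 phi * N p2 psi) `^ r)%E.
Proof.
have inv2 (p : R) : 2 <= p -> (p%:E^-1)%E = (p^-1)%:E.
  by move=> p_ge2; rewrite inver gt_eqF// (lt_le_trans _ p_ge2).
case: p1 => [p1| |//]; case: p2 => [p2| |//]; rewrite ?lee_fin => h1 h2 r0 hr mphi mpsi phi0 psi0.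
- apply: integral_convolution_sqr_le_fin => //; apply: EFin_inj.
  by rewrite hr !inv2.
- move: hr; rewrite invey adde0 inv2// => -[] /(congr1 GRing.inv); rewrite !invrK => rp1; rewrite -rp1 in h1 *.
  rewrite [X in (_ <= X `^ _)%E]muleC.
  under eq_integral do rewrite muleC.
  exact: integral_convolution_sqr_le_sup.
- move: hr; rewrite invey add0e inv2// => -[] /(congr1 GRing.inv); rewrite !invrK => rp2; rewrite -rp2 in h2 *.
  exact: integral_convolution_sqr_le_sup.
- by move: hr; rewrite invey add0e => -[] /eqP; rewrite invr_eq0 gt_eqF.
Qed.

End convolution_hoelder.

(** * The uniform estimate *)

Section uniform_estimate.
Context (R : realType).
Local Notation mu := (@lebesgue_measure R).

(** Lengths are positive, so the infimum is nonnegative and the supremum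
    positive; this is what forces [K > 0]. *)
Lemma comparable_lengthsP (K : R) (Omega : set (set R)) (w w' : set R) :
  (forall u, Omega u -> bounded_interval u) -> comparable_lengths K Omega ->
  Omega w -> Omega w' -> 0 < K /\ ilength w <= K * ilength w'.
Proof.
move=> hb hK Ow Ow'.
have l0 u : Omega u -> 0 < ilength u by move/hb; exact: ilength_gt0.
have wK : ((ilength w)%:E <= K%:E * ereal_inf [set (ilength u)%:E | u in Omega])%E.
  by apply: le_trans hK; apply: ereal_sup_ubound; exists w.
have inf0 : (0 <= ereal_inf [set (ilength u)%:E | u in Omega])%E.
  by apply: le_ereal_inf_tmp => _ [u Ou <-]; rewrite lee_fin ltW// l0.
have K0 : 0 < K.
  rewrite ltNge; apply/negP => K0; have := l0 _ Ow; apply/negP; rewrite -leNgt -lee_fin.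
  by apply: le_trans wK _; apply: mule_le0_ge0.
split=> //; rewrite -lee_fin EFinM; apply: le_trans wK _.
apply: lee_wpmul2l; first by rewrite lee_fin ltW.
by apply: ereal_inf_lbound; exists w'.
Qed.

Lemma well_distributed_ge0 (N : R) (Omega : set (set R)) : well_distributed N Omega -> 0 <= N.
Proof.
move=> /(_ 0) hN; rewrite -lee_fin; apply: le_trans hN.
by apply: esum_ge0 => w _; rewrite lee_fin.
Qed.

Lemma normc_damped_sqr (L : R) f g x t : normc (damped L f g x t) ^+ 2 =
  normc (f (x - t)) ^+ 2 * normc (g (t + x)) ^+ 2 * poisson 1 (L * t) ^+ 2.
Proof.
by rewrite /damped /twisted !normcM normcR ger0_norm ?poisson_ge0// !exprMn.
Qed.

(** The factor [L] of the pointwise bound cancels the [1 / L] lost by averaging,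
    so the final constant depends on [A] alone. *)
Lemma Lnorm_square_function_le (p1 p2 : \bar R) (r A L : R)
    (Omega : set (set R)) (chi : set R -> R -> R[i]) (f g : R -> R[i]) :
  (2%:E <= p1)%E -> (2%:E <= p2)%E -> 0 < r -> r <= 2 ->
  (r^-1)%:E = (p1^-1 + p2^-1)%E -> 0 < L -> 0 <= A ->
  schwartz f -> schwartz g ->
  (forall x, \esum_(w in Omega) (normc (bilinear_op (chi w) f g x) ^+ 2)%:E <=
     (A * L)%:E * \int[mu]_t (normc (damped L f g x t) ^+ 2)%:E)%E ->
  (Lnorm mu r%:E (square_function Omega chi f g) <=
   ((A * (9 * pi ^+ 2 / 4)) `^ 2^-1)%:E * cLnorm p1 f * cLnorm p2 g)%E.
Proof.
move=> h1 h2 r0 r2 hr L0 A0 sf sg hE.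
have c0 : 0 <= 9 * pi ^+ 2 / 4 :> R by rewrite divr_ge0 ?mulr_ge0 ?sqr_ge0 ?pi_ge0.
have mnf := cmeasurable_normc (schwartz_cmeasurable sf).
have mng := cmeasurable_normc (schwartz_cmeasurable sg).
pose u (s : R) := normc (f s) ^+ 2; pose v (s : R) := normc (g s) ^+ 2.
have meas_u : measurable_fun setT u by exact: measurable_funX.
have mv : measurable_fun setT v by exact: measurable_funX.
have u0 s : 0 <= u s := sqr_ge0 _.
have v0 s : 0 <= v s := sqr_ge0 _.
have q01 : 0 < r / 2 <= 1 by rewrite divr_gt0//= ler_pdivrMr// mul1r.
have q0 : 0 <= r / 2 by case/andP: q01 => /ltW.
have hM x : (\esum_(w in Omega) (normc (bilinear_op (chi w) f g x) ^+ 2)%:E <=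
    (A * L)%:E * midpoint_mean L u v x)%E.
  rewrite [X in (_ * X)%E](_ : _ = \int[mu]_t (normc (damped L f g x t) ^+ 2)%:E)%E//.
  by apply: eq_integral => t _; rewrite normc_damped_sqr.
have E0 x : (0 <= \esum_(w in Omega) (normc (bilinear_op (chi w) f g x) ^+ 2)%:E)%E.
  by apply: esum_ge0 => w _; rewrite lee_fin sqr_ge0.
have key : (\int[mu]_x (`|square_function Omega chi f g x| `^ r) <=
    (((A * (9 * pi ^+ 2 / 4)) `^ 2^-1)%:E * cLnorm p1 f * cLnorm p2 g) `^ r)%E.
  apply: (@le_trans _ _ (\int[mu]_x ((A * L)%:E `^ (r / 2) * midpoint_mean L u v x `^ (r / 2)))%E).
    apply: ge0_integral_mono => x; first exact: poweR_ge0.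
    rewrite gee0_abs ?poweR_ge0// /square_function -poweRrM -poweRM ?midpoint_mean_ge0//; last first.
      by rewrite lee_fin mulr_ge0// ltW.
    by rewrite mulrC; apply: poweR_le.
  rewrite ge0_integralZl//; last 3 first.
  - by apply: measurable_poweR_fun; exact: measurable_midpoint_mean.
  - by move=> x _; exact: poweR_ge0.
  - exact: poweR_ge0.
  have := integral_midpoint_mean_poweR_le L0 meas_u mv u0 v0 q01.
  move=> /(lee_wpmul2l (poweR_ge0 (A * L)%:E (r / 2))) H; apply: le_trans H _.
  have := integral_convolution_sqr_le (measurable_cauchy L) (cauchy_ge0 L0)
    (integral_cauchy L0) h1 h2 r0 hr mnf mng (fun s => normc_ge0 _) (fun s => normc_ge0 _).
  set I := (\int[mu]_y _)%E => H.
  have cL0 : 0 <= 9 * pi ^+ 2 / (4 * L).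
    by rewrite divr_ge0 ?mulr_ge0 ?sqr_ge0 ?pi_ge0// ltW.
  have AL0 : 0 <= A * L by rewrite mulr_ge0// ltW.
  rewrite muleA -poweRM ?lee_fin//.
  rewrite -EFinM (_ : A * L * _ = A * (9 * pi ^+ 2 / 4)); last by field; rewrite gt_eqF.
  rewrite -[X in (_ <= X `^ _)%E]muleA poweRM ?mule_ge0 ?Lnorm_ge0 ?lee_fin ?powR_ge0//.
  rewrite [X in (_ <= X * _)%E](_ : _ = (A * (9 * pi ^+ 2 / 4))%:E `^ (r / 2))%E; last first.
    by rewrite -poweR_EFin -poweRrM [2^-1 * r]mulrC.
  by apply: lee_wpmul2l; first exact: poweR_ge0.
rewrite unlock /=.
have rhs0 : (0 <= ((A * (9 * pi ^+ 2 / 4)) `^ 2^-1)%:E * cLnorm p1 f * cLnorm p2 g)%E.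
  by rewrite !mule_ge0 ?Lnorm_ge0 ?lee_fin ?powR_ge0.
set B := (_ * cLnorm p1 f * cLnorm p2 g)%E in key rhs0 *.
rewrite -[B]poweRe1// -(divff (lt0r_neq0 r0)) poweRrM.
apply: poweR_le => //; first by rewrite invr_ge0 ltW.
by apply: integral_ge0 => x _; exact: poweR_ge0.
Qed.

Lemma inve_ge2 (p : \bar R) : (2%:E <= p)%E -> exists2 a : R, p^-1%E = a%:E & 0 <= a <= 2^-1.
Proof.
case: p => [p| |//]; rewrite ?lee_fin => p2.
  have p0 : 0 < p by rewrite (lt_le_trans _ p2).
  by exists p^-1; rewrite ?inver ?gt_eqF// invr_ge0 ltW//= lef_pV2 ?posrE.
by exists 0; rewrite ?invey// lexx/= invr_ge0.
Qed.

(** The condition on the conjugate exponent reads [1 - 1 / p3 <= 1 / 2], that is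
    [p3 <= 2]. *)
Lemma exponent_bounds (p1 p2 p3 : \bar R) : (2%:E <= p1)%E -> (2%:E <= p2)%E ->
  (2%:E <= hoelder_conjugate p3)%E -> (0 < p3^-1)%E -> (p3^-1 = p1^-1 + p2^-1)%E ->
  exists2 r : R, p3 = r%:E & 0 < r <= 2.
Proof.
move=> /inve_ge2[a ha _] /inve_ge2[b hb _] /inve_ge2[c hc /andP[_ c2]].
rewrite ha hb -EFinD => pos hp; move: pos hp hc.
case: p3 => [r| |]; rewrite ?invey ?inveNy ?ltxx// => pos hp hc.
have r0 : r != 0 by apply/eqP => r0; move: hp; rewrite r0 inve0.
exists r => //.
have := @hoelder_conjugate_eq1 R r%:E (ltNyr _); rewrite eqe => /(_ r0).
rewrite hc; move: pos; rewrite inver (negbTE r0) lte_fin invr_gt0 => r_gt0.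
rewrite -EFinD => -[h]; rewrite r_gt0 /=.
have : 2^-1 <= r^-1 by lra.
by rewrite lef_pV2 ?posrE.
Qed.

End uniform_estimate.

Theorem theorem1p9 (R : realType) (p1 p2 p3 : \bar R)
    (hp1 : (2%:E <= p1)%E) (hp2 : (2%:E <= p2)%E)
    (hp3 : (2%:E <= hoelder_conjugate p3)%E)
    (hpos : (0 < p3^-1)%E) (hp : (p3^-1 = p1^-1 + p2^-1)%E)
    (N K : R) (Cst : nat -> R) :
  exists C : R,
    forall (Omega : set (set R)) (chi : set R -> R -> R[i]),
      (forall w, Omega w -> bounded_interval w) ->
      well_distributed N Omega ->
      comparable_lengths K Omega ->
      (forall w, Omega w -> adapted Cst w (chi w)) ->
      forall f g : R -> R[i], schwartz f -> schwartz g ->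
        (Lnorm (@lebesgue_measure R) p3 (square_function Omega chi f g)
           <= C%:E * cLnorm p1 f * cLnorm p2 g)%E.
Proof.
have [r p3E /andP[r0 r2]] := exponent_bounds hp1 hp2 hp3 hpos hp.
have hr : (r^-1)%:E = (p1^-1 + p2^-1)%E by rewrite -hp p3E inver gt_eqF.
(* The constant of the pointwise bound without its factor L. *)
pose A := (2 * pi) ^+ 2 * (Cst 0%N + K ^+ 2 * Cst 2%N) ^+ 2 * K * N * (2 * pi).
exists ((A * (9 * pi ^+ 2 / 4)) `^ 2^-1) => Omega chi hb hN hK hchi f g sf sg.
have [emp | /set0P[w0 Ow0]] := eqVneq Omega set0.
  have -> : square_function Omega chi f g = cst 0%E.
    by apply/funext => x; rewrite /square_function emp esum_set0 poweR0r.
  rewrite p3E Lnorm0 ?eqe ?gt_eqF//.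
  by rewrite !mule_ge0 ?Lnorm_ge0 ?lee_fin ?powR_ge0.
have L0 := ilength_gt0 (hb _ Ow0).
(* Any interval of the collection can serve as the scale L. *)
have [K0 _] := comparable_lengthsP hb hK Ow0 Ow0.
have N0 := well_distributed_ge0 hN.
rewrite p3E; apply: (Lnorm_square_function_le hp1 hp2 r0 r2 hr L0) => //.
  have pi20 : 0 <= 2 * pi :> R by rewrite mulr_ge0 ?pi_ge0.
  rewrite /A; apply: (mulr_ge0 _ pi20); apply: (mulr_ge0 _ N0); apply: (mulr_ge0 _ (ltW K0)).
  by rewrite mulr_ge0 ?sqr_ge0.
move=> x; apply: esum_sqr_bilinear_op_le => //; first exact: ltW.
move=> w Ow; split.
- by have [] := comparable_lengthsP hb hK Ow0 Ow.
- by have [] := comparable_lengthsP hb hK Ow Ow0.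
Qed.
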